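(* Let $q\in C^\infty(\mathbb{R})$ be strictly positive, let $x(t)=\int_0^t\sqrt{q(u)}\,du$, let $t(x)$ denote the inverse of the function $x(t)$, and suppose that the function $p(x)=2\{t,x\}$ is an element of $\mathcal{S}(\mathbb{R})$. Let $\lambda,\Gamma,\mu$ be positive real numbers such that $\lambda\ge 4\max\{1/\mu,\Gamma\}$ and $$|\widehat{p}(\xi)|\le \Gamma\exp(-\mu|\xi|)\quad\text{for all }\xi\in\mathbb{R}.$$ Let $\sigma,\nu\in \mathcal{S}(\mathbb{R})$ be functions such that $$\sigma(x)=S[T[\sigma]](x)+p(x)+\nu(x)\quad\text{for all }x\in\mathbb{R},$$ $$|\widehat{\sigma}(\xi)|\le \frac{3\Gamma}{2}\exp(-\mu|\xi|)\ \text{ for all }|\xi|\le\sqrt2\,\lambda,\qquad \widehat{\sigma}(\xi)=0\ \text{ for all }|\xi|>\sqrt2\,\lambda,$$ $$\|\nu\|_\infty\le\frac{\Gamma}{\mu}\exp(-\mu\lambda).$$ Let $$C_1=\max\left\{24\Gamma,\sqrt{\frac{16\Gamma}{\mu}}\right\}$$ and suppose that $$\lambda\ge\max\left\{4\Gamma,\frac4\mu,\frac{\Gamma}{4\mu},\frac2\mu W_0(C_1\mu)\right\}.$$ Let $x_0$ be a real number such that $$|p(x)|\le\frac{C_1^2}{16}\exp(-\mu\lambda)\quad\text{for all }x\le x_0,$$ and let $\delta(x)=T[\sigma](x)$. Then $$|\delta(x)|\le\frac{C_1}{2\lambda}\exp\left(-\frac{\mu\lambda}{2}\right)\quad\text{and}\quad|\delta'(x)|\le\frac{C_1}{2}\exp\left(-\frac{\mu\lambda}{2}\right)$$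 for all $x\le x_0$.
   Context: $\mathcal{S}(\mathbb{R})$ is the space of (complex-valued) Schwartz functions on $\mathbb{R}$. The Fourier transform is $\widehat f(\xi)=\int_{-\infty}^\infty \exp(-ix\xi)f(x)\,dx$. The Schwarzian derivative of a smooth function $f$ of the variable $t$ is $\{f,t\}=\frac{f'''(t)}{f'(t)}-\frac32\left(\frac{f''(t)}{f'(t)}\right)^2$; thus $\{t,x\}$ is the Schwarzian derivative, with respect to $x$, of the inverse function $t(x)$ (which is understood to be defined on all of $\mathbb{R}$). For $f\in \mathcal{S}(\mathbb{R})$, $$T[f](x)=\frac{1}{4\lambda}\int_{-\infty}^\infty\sin(2\lambda|x-y|)f(y)\,dy .$$ $S$ is the nonlinear differential operator $$S[f](x)=\frac{(f'(x))^2}{4}-4\lambda^2\left(\frac{(f(x))^2}{2!}+\frac{(f(x))^3}{3!}+\cdots\right).$$ $W_0$ is the branch of the Lambert $W$ function (the inverse of $z\mapsto z\exp(z)$) that is real-valued and greater than or equal to $-1$ on $[-1/e,\infty)$. *)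

(* Defs.v *)
From Stdlib Require Import Reals Factorial.
From Coquelicot Require Import Coquelicot.

Open Scope R_scope.

(* Calculus of complex-valued functions of a real variable (and complex series),
   performed on real and imaginary parts. *)

Definition Cex_derive_n (f : R -> C) (n : nat) (x : R) : Prop :=
  ex_derive_n (fun y => Re (f y)) n x /\ ex_derive_n (fun y => Im (f y)) n x.

Definition CDerive_n (f : R -> C) (n : nat) (x : R) : C :=
  (Derive_n (fun y => Re (f y)) n x, Derive_n (fun y => Im (f y)) n x).

Definition CDerive (f : R -> C) (x : R) : C :=
  (Derive (fun y => Re (f y)) x, Derive (fun y => Im (f y)) x).

(* Integral over the whole real line, as an improper Riemann integral. *)
Definition CInt (f : R -> C) : C :=
  (RInt_gen (fun y => Re (f y)) (Rbar_locally m_infty) (Rbar_locally p_infty),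
   RInt_gen (fun y => Im (f y)) (Rbar_locally m_infty) (Rbar_locally p_infty)).

Definition CSeries (a : nat -> C) : C :=
  (Series (fun n => Re (a n)), Series (fun n => Im (a n))).

Definition smooth (f : R -> R) : Prop := forall n x, ex_derive_n f n x.

Definition schwartz (f : R -> C) : Prop :=
  (forall n x, Cex_derive_n f n x) /\
  (forall m n : nat, exists M : R,
     forall x : R, Rabs x ^ m * Cmod (CDerive_n f n x) <= M).

Definition sup_norm (f : R -> C) : Rbar :=
  Lub_Rbar (fun r => exists x, r = Cmod (f x)).

(* exp (i theta) *)
Definition expi (theta : R) : C := (cos theta, sin theta).

Definition fourier (f : R -> C) (xi : R) : C :=
  CInt (fun x => expi (- (x * xi)) * f x)%C.

Definition schwarzian (f : R -> R) (t : R) : R :=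
  Derive_n f 3 t / Derive_n f 1 t
  - 3 / 2 * (Derive_n f 2 t / Derive_n f 1 t) ^ 2.

Definition phase (q : R -> R) (t : R) : R := RInt (fun u => sqrt (q u)) 0 t.

Definition T_op (lambda : R) (f : R -> C) (x : R) : C :=
  (RtoC (1 / (4 * lambda)) *
   CInt (fun y => RtoC (sin (2 * lambda * Rabs (x - y))) * f y))%C.

Definition S_op (lambda : R) (f : R -> C) (x : R) : C :=
  (CDerive f x ^ 2 / 4
   - RtoC (4 * lambda ^ 2) *
     CSeries (fun k => f x ^ (k + 2) / RtoC (INR (fact (k + 2)))))%C.

(* The unique w >= -1 with w exp w = z; meaningful only for z >= -1/e. *)
Definition lambert_W0 (z : R) : R :=
  iota (fun w : R => -1 <= w /\ w * exp w = z).

(* Main.v *)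
Require Import Defs.
From Stdlib Require Import Reals Lra Lia Factorial.
From Coquelicot Require Import Coquelicot.

(** Put [delta = T sigma], [X = mu lambda] and [M = C1/2 exp(-X/2)]; the claim is
    [lambda |delta| <= M] and [|delta'| <= M] on the half-line [x <= x0].

    The kernel of [T] is a fundamental solution of [d^2/dx^2 + 4 lambda^2], and the
    transform of [sigma] vanishes at [+-2 lambda].  Hence the homogeneous part disappears
    at both ends:
    [delta(x) = 1/(2 lambda) int_{-oo}^x sin(2 lambda (x-y)) sigma(y) dy], the functions
    [delta] and [delta'] decay rapidly, [delta'' + 4 lambda^2 delta = sigma], and
    [delta^(xi) = sigma^(xi) / (4 lambda^2 - xi^2)] lives in the band
    [|xi| <= sqrt 2 lambda] ([T_op_structure], [T_op_properties], [fourier_T_op_bounds]).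

    On the half-line, [sigma = S[delta] + p + nu] is quadratic in [(lambda delta, delta')] up
    to an error [M^2 / 2] ([S_op_bound]).  So it would suffice to invert the oscillator
    locally; but it is undamped, and a force of size [eps] acting during an infinite
    time gives no bound at all.  The frequency information has to be used on the half-line.

    The device is the half-period difference [R f (x) = (f(x) - f(x-h))/2] with
    [h = PI/(2 lambda)] ([half_diff]).  A free oscillation of frequency [2 lambda] changes
    sign under the shift by [h], so [R] fixes it, and [f - R f = (f(x) + f(x-h))/2] only feels
    the values of [sigma] on [[x-h, x]]: replacing [f] by [R^n f] costs [n] times a local
    bound ([iter_half_diff_close]).  On the other side of the Fourier transform, [R^n]
    multiplies by a factor of modulus [|sin(xi h/2)|^n], which is small exactly where
    [exp(-mu |xi|)] is not; as soon as [n >= X/2] the product of the two is at most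
    [exp(-X/2)] at every frequency ([half_diff_filter_le]).  Hence [R^n delta] and
    [R^n delta'] are uniformly small ([band_limited_sup_bounds]).

    With [n] about [X/2], the supremum [Q] of [lambda |delta|] and [|delta'|] over the half-line
    satisfies an inequality [Q <= M/24 + c (X/lambda) (21/4 Q^2 + M^2/2)].  The whole-line
    bound [Q <= 3 Gamma/(8 X)] turns the quadratic term into a small multiple of [Q], and
    [Q <= M] follows ([quadratic_closure]).

    Bounds on a Fourier transform pass to the function by Abel summation against the
    Poisson kernel ([sup_bound_of_cosine_transform], [fourier_sup_bound]), with all improper
    integrals expressed through antiderivatives. *)

Open Scope R_scope.

(** * Integrals over the real line *)

(** The integral over the line is encoded by a normalised antiderivative: linearity,
    translation and comparison then reduce to facts about derivatives and limits.
    [RInt_gen_total] ties it to the improper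
    Riemann integral. *)
Definition total (f : R -> R) (l : R) : Prop :=
  exists G : R -> R, (forall x, is_derive G x (f x)) /\
    is_lim G m_infty 0 /\ is_lim G p_infty l.

Lemma is_lim_add (f g : R -> R) (x : Rbar) (a b : R) :
  is_lim f x a -> is_lim g x b -> is_lim (fun y => f y + g y) x (a + b).
Proof. intros Hf Hg. apply (is_lim_plus f g x a b); [exact Hf | exact Hg | reflexivity]. Qed.

Lemma is_lim_cmul (f : R -> R) (x : Rbar) (c a : R) :
  is_lim f x a -> is_lim (fun y => c * f y) x (c * a).
Proof. intros Hf. exact (is_lim_scal_l f c x a Hf). Qed.

Lemma is_lim_le_const (f : R -> R) (x : Rbar) (a b : R) :
  is_lim f x a -> Rbar_locally' x (fun y => f y <= b) -> a <= b.
Proof.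
  intros Hf H. exact (is_lim_le_loc f (fun _ => b) x a b H Hf (is_lim_const b x)).
Qed.

Lemma is_lim_ge_const (f : R -> R) (x : Rbar) (a b : R) :
  is_lim f x a -> Rbar_locally' x (fun y => b <= f y) -> b <= a.
Proof.
  intros Hf H. exact (is_lim_le_loc (fun _ => b) f x b a H (is_lim_const b x) Hf).
Qed.

Lemma is_lim_affine (f : R -> R) (c d l : R) (x : Rbar) (hx : x = p_infty \/ x = m_infty) :
  0 < c -> is_lim f x l -> is_lim (fun y => f (c * y + d)) x l.
Proof.
  intros Hc Hf. apply is_lim_comp with x.
  - exact Hf.
  - destruct hx as [-> | ->]; intros P [M HM].
    + exists ((M - d) / c). intros y Hy. apply HM.
      apply Rmult_lt_compat_l with (r := c) in Hy; [|lra].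
      replace (c * ((M - d) / c)) with (M - d) in Hy by (field; lra). lra.
    + exists ((M - d) / c). intros y Hy. apply HM.
      apply Rmult_lt_compat_l with (r := c) in Hy; [|lra].
      replace (c * ((M - d) / c)) with (M - d) in Hy by (field; lra). lra.
  - destruct hx as [-> | ->]; exists 0; intros; discriminate.
Qed.

Lemma is_derive_monotone (f df : R -> R) (a b : R) :
  a <= b -> (forall x, a <= x <= b -> is_derive f x (df x)) ->
  (forall x, a < x < b -> 0 <= df x) -> f a <= f b.
Proof.
  intros Hab Hd Hp. destruct (Req_dec a b) as [->|Hne]; [lra|].
  destruct (MVT_cor2 f df a b) as [c [Hc1 Hc2]]; [lra| |].
  - intros c Hc. apply is_derive_Reals. now apply Hd.
  - specialize (Hp c Hc2). nra.
Qed.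

Lemma total_antiderivative (f G : R -> R) (a b : R) :
  (forall x, is_derive G x (f x)) -> is_lim G m_infty a -> is_lim G p_infty b ->
  total f (b - a).
Proof.
  intros Hd Ha Hb. exists (fun x => G x + - a). split; [|split].
  - intros x. auto_derive; [now exists (f x)|].
    replace (Derive (fun y => G y) x) with (f x) by (symmetry; apply is_derive_unique, Hd).
    ring.
  - replace 0 with (a + - a) by ring.
    apply is_lim_add; [exact Ha | apply is_lim_const].
  - apply is_lim_add; [exact Hb | apply is_lim_const].
Qed.

Lemma total_ext (f g : R -> R) (l : R) :
  (forall x, f x = g x) -> total f l -> total g l.
Proof.
  intros H [G [H1 [H2 H3]]]. exists G. split; [|split]; try assumption.
  intros x. rewrite <- H. apply H1.
Qed.

Lemma total_plus (f g : R -> R) (a b : R) :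
  total f a -> total g b -> total (fun x => f x + g x) (a + b).
Proof.
  intros [F [F1 [F2 F3]]] [G [G1 [G2 G3]]]. exists (fun x => F x + G x).
  split; [|split].
  - intros x. apply (is_derive_plus F G x (f x) (g x)); auto.
  - replace 0 with (0 + 0) by ring. now apply is_lim_add.
  - now apply is_lim_add.
Qed.

Lemma total_scal (f : R -> R) (c a : R) :
  total f a -> total (fun x => c * f x) (c * a).
Proof.
  intros [F [F1 [F2 F3]]]. exists (fun x => c * F x). split; [|split].
  - intros x. apply (is_derive_scal F x c (f x)); auto.
  - replace 0 with (c * 0) by ring. now apply is_lim_cmul.
  - now apply is_lim_cmul.
Qed.

Lemma total_shift (f : R -> R) (d l : R) :
  total f l -> total (fun y => f (y + d)) l.
Proof.
  intros [F [F1 [F2 F3]]]. exists (fun y => F (1 * y + d)). split; [|split].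
  - intros x. auto_derive; rewrite ?Rmult_1_l; [now exists (f (x + d))|].
    replace (Derive (fun y => F y) (x + d)) with (f (x + d)); [ring|].
    symmetry. apply is_derive_unique, F1.
  - apply is_lim_affine; [now right| lra | assumption].
  - apply is_lim_affine; [now left| lra | assumption].
Qed.

Lemma total_nonneg (f : R -> R) (l : R) :
  (forall x, 0 <= f x) -> total f l -> 0 <= l.
Proof.
  intros Hf [F [F1 [F2 F3]]].
  assert (Hm : forall a b, a <= b -> F a <= F b).
  { intros a b Hab. apply is_derive_monotone with (df := f); auto. }
  assert (H0 : forall x, 0 <= F x).
  { intros x. apply (is_lim_le_const F m_infty); [exact F2|].
    exists x. intros y Hy. apply Hm. lra. }
  apply (is_lim_ge_const F p_infty); [exact F3|].
  exists 0. intros y _. apply H0.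
Qed.

Lemma total_le (f g : R -> R) (a b : R) :
  (forall x, f x <= g x) -> total f a -> total g b -> a <= b.
Proof.
  intros H Hf Hg.
  assert (0 <= b + -1 * a); [|lra].
  apply (total_nonneg (fun x => g x + -1 * f x)).
  - intros x. specialize (H x). lra.
  - apply total_plus; [assumption | now apply total_scal].
Qed.

Lemma total_unique (f : R -> R) (a b : R) : total f a -> total f b -> a = b.
Proof.
  intros Ha Hb. apply Rle_antisym;
    [apply (total_le f f a b) | apply (total_le f f b a)]; auto; intros; lra.
Qed.

Lemma atan_lim_p : is_lim atan p_infty (PI / 2).
Proof.
  apply is_lim_spec. intros eps. 
  assert (He := cond_pos eps). assert (Hpi := PI_RGT_0).
  set (e := Rmin eps (PI / 4)).
  assert (0 < e /\ e <= eps /\ e < PI / 2) as [E1 [E2 E3]].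
  { unfold e. split; [apply Rmin_pos; lra|].
    split; [apply Rmin_l|]. assert (h := Rmin_r eps (PI / 4)). lra. }
  exists (tan (PI / 2 - e)). intros x Hx.
  assert (H1 := atan_increasing _ _ Hx). rewrite atan_tan in H1 by lra.
  assert (H2 := atan_bound x). rewrite Rabs_left; lra.
Qed.

Lemma atan_lim_m : is_lim atan m_infty (- (PI / 2)).
Proof.
  apply is_lim_ext with (fun x => - atan (- x)).
  { intros. rewrite atan_opp. ring. }
  apply (is_lim_opp (fun x => atan (- x)) m_infty (PI / 2)).
  apply is_lim_comp with p_infty; [exact atan_lim_p| |].
  - intros P [M HM]. exists (- M). intros y Hy. apply HM. lra.
  - exists 0. intros; discriminate.
Qed.

Lemma poisson_total (s : R) : 0 < s -> total (fun y => s / (s ^ 2 + y ^ 2)) PI.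
Proof.
  intros Hs. replace PI with (PI / 2 - - (PI / 2)) by field.
  apply total_antiderivative with (fun y => atan (/ s * y + 0)).
  - intros y. auto_derive; [trivial|].
    field. assert (0 < s * s) by nra. assert (0 <= y * y) by nra. repeat split; nra.
  - apply (is_lim_affine atan); [now right | now apply Rinv_0_lt_compat | exact atan_lim_m].
  - apply (is_lim_affine atan); [now left | now apply Rinv_0_lt_compat | exact atan_lim_p].
Qed.

Lemma cauchy_total : total (fun y => / (1 + y ^ 2)) PI.
Proof.
  apply (total_ext (fun y => 1 / (1 ^ 2 + y ^ 2))); [|apply poisson_total; lra].
  intros y. field. nra.
Qed.

(** The mean value inequality in the form used throughout: the bound on the derivative is
    only required inside the interval, so isolated exceptional points may be used as
    end points. *)
Lemma increment_le (F G f g : R -> R) (a b : R) :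
  a <= b ->
  (forall x, a <= x <= b -> is_derive F x (f x)) ->
  (forall x, a <= x <= b -> is_derive G x (g x)) ->
  (forall x, a < x < b -> Rabs (f x) <= g x) -> Rabs (F b - F a) <= G b - G a.
Proof.
  intros Hab HF HG H.
  assert (G a + -1 * F a <= G b + -1 * F b).
  { apply (is_derive_monotone (fun x => G x + -1 * F x) (fun x => g x + -1 * f x) a b Hab).
    - intros x Hx. apply (is_derive_plus G (fun y => -1 * F y) x (g x) (-1 * f x)); [auto|].
      apply (is_derive_scal F x (-1) (f x)); auto.
    - intros x Hx. specialize (H x Hx). apply Rabs_le_between in H. lra. }
  assert (G a + 1 * F a <= G b + 1 * F b).
  { apply (is_derive_monotone (fun x => G x + 1 * F x) (fun x => g x + 1 * f x) a b Hab).
    - intros x Hx. apply (is_derive_plus G (fun y => 1 * F y) x (g x) (1 * f x)); [auto|].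
      apply (is_derive_scal F x 1 (f x)); auto.
    - intros x Hx. specialize (H x Hx). apply Rabs_le_between in H. lra. }
  apply Rabs_le. lra.
Qed.

(** Cauchy criterion: the oscillation of [F] near the point at infinity is at most that
    of [G]. *)
Lemma lim_of_dominated (F G : R -> R) (x : Rbar) (l : R) 
  (hx : x = p_infty \/ x = m_infty) :
  (forall a b, a <= b -> Rabs (F b - F a) <= G b - G a) ->
  is_lim G x l -> exists m : R, is_lim F x m.
Proof.
  intros H HG.
  assert (Hs : forall u v, Rabs (F v - F u) <= Rabs (G v - G u)).
  { intros u v. destruct (Rle_dec u v) as [h|h].
    - eapply Rle_trans; [now apply H | apply Rle_abs].
    - rewrite (Rabs_minus_sym (F v)), (Rabs_minus_sym (G v)).
      eapply Rle_trans; [apply H; lra | apply Rle_abs]. }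
  assert (PF : ProperFilter (Rbar_locally' x)) by apply Rbar_locally'_filter.
  apply (@filterlim_locally_cauchy R R_CompleteSpace _ PF F).
  intros eps. 
  assert (HC := proj2 (@filterlim_locally_cauchy R R_CompleteSpace _ PF G)).
  destruct (HC (ex_intro _ l HG) eps) as [P [P1 P2]].
  exists P. split; [exact P1|]. intros u v Hu Hv.
  specialize (P2 u v Hu Hv).
  change (Rabs (F v - F u) < eps). eapply Rle_lt_trans; [apply Hs | exact P2].
Qed.

Lemma total_exists (f : R -> R) (K : R) :
  (forall x, continuous f x) -> (forall x, Rabs (f x) <= K / (1 + x ^ 2)) ->
  exists l, total f l.
Proof.
  intros Hc Hb. set (F := fun t => RInt f 0 t).
  assert (HF : forall x, is_derive F x (f x)).
  { intros x. apply (is_derive_RInt f F 0 x); [|apply Hc].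
    apply filter_forall. intros t. apply (RInt_correct (V := R_CompleteNormedModule) f 0 t).
    apply (ex_RInt_continuous (V := R_CompleteNormedModule)). auto. }
  destruct (total_scal _ K PI cauchy_total) as [G [G1 [G2 G3]]].
  assert (HFG : forall a b, a <= b -> Rabs (F b - F a) <= G b - G a).
  { intros a b Hab. apply increment_le with f (fun x => K * / (1 + x ^ 2)); auto. }
  destruct (lim_of_dominated F G m_infty 0) as [m Hm]; auto.
  destruct (lim_of_dominated F G p_infty (K * PI)) as [p Hp]; auto.
  exists (p - m). now apply total_antiderivative with F.
Qed.

Lemma RInt_gen_total (f : R -> R) (l : R) :
  (forall x, continuous f x) -> total f l ->
  RInt_gen f (Rbar_locally m_infty) (Rbar_locally p_infty) = l.
Proof.
  intros Hc [G [G1 [G2 G3]]].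
  apply is_RInt_gen_unique; try apply Proper_StrongProper; try apply Rbar_locally_filter.
  assert (E : forall x, Derive G x = f x) by (intros; now apply is_derive_unique).
  apply is_RInt_gen_ext with (Derive G); try apply Rbar_locally_filter.
  { exists (fun _ => True) (fun _ => True); try apply filter_true. intros; apply E. }
  replace l with (l - 0) by ring.
  apply is_RInt_gen_Derive; try apply Rbar_locally_filter.
  - exists (fun _ => True) (fun _ => True); try apply filter_true.
    intros; eexists; apply G1.
  - exists (fun _ => True) (fun _ => True); try apply filter_true.
    intros. apply continuous_ext with f; [intros; now rewrite E | apply Hc].
  - exact G2.
  - exact G3.
Qed.

(** * From the cosine transform to the supremum *)

Lemma total_dominated (f : R -> R) (l C : R) :
  (forall y, Rabs (f y) <= C / (1 + y ^ 2)) -> total f l -> Rabs l <= C * PI.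
Proof.
  intros H Hf. assert (HC := total_scal _ C PI cauchy_total). apply Rabs_le. split.
  - assert (-1 * l <= C * PI); [|lra].
    apply (total_le _ _ _ _) with (2 := total_scal _ (-1) _ Hf) (3 := HC).
    intros y. specialize (H y). apply Rabs_le_between in H. unfold Rdiv in H. lra.
  - apply (total_le _ _ _ _) with (2 := Hf) (3 := HC).
    intros y. specialize (H y). apply Rabs_le_between in H. unfold Rdiv in H. lra.
Qed.

Lemma lipschitz_continuous (u : R -> R) (L : R) :
  (forall x y, Rabs (u x - u y) <= L * Rabs (x - y)) -> forall x, continuous u x.
Proof.
  intros HL x P [eps HP].
  assert (HL' : 0 < Rabs L + 1) by (assert (h := Rabs_pos L); lra).
  exists (mkposreal _ (Rdiv_lt_0_compat _ _ (cond_pos eps) HL')).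
  intros y Hy. apply HP. change (Rabs (u y - u x) < eps).
  change (Rabs (y - x) < eps / (Rabs L + 1)) in Hy.
  apply Rle_lt_trans with ((Rabs L + 1) * Rabs (y - x)).
  - eapply Rle_trans; [apply HL|]. apply Rmult_le_compat_r; [apply Rabs_pos|].
    assert (h := Rle_abs L). lra.
  - apply Rmult_lt_compat_l with (r := Rabs L + 1) in Hy; [|assumption].
    replace ((Rabs L + 1) * (eps / (Rabs L + 1))) with (pos eps) in Hy by (field; lra).
    exact Hy.
Qed.

(** The Poisson means of [u] converge to [PI u(0)].  Since [s |y| / (s^2 + y^2)] is not
    integrable, the Lipschitz bound is first traded for
    [|u(y) - u(0)| <= eta + C y^2/(1+y^2)], and
    [s y^2/((s^2+y^2)(1+y^2)) <= s/(1+y^2)] has integral of order [s]. *)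
Lemma poisson_limit (u : R -> R) (L K eta : R) :
  (forall x y, Rabs (u x - u y) <= L * Rabs (x - y)) ->
  (forall y, Rabs (u y) <= K) -> 0 < eta ->
  exists C, 0 < C /\ forall s P, 0 < s ->
    total (fun y => u y * (s / (s ^ 2 + y ^ 2))) P ->
    Rabs (P - u 0 * PI) <= eta * PI + C * s * PI.
Proof.
  intros HL HK He.
  assert (HK0 : 0 <= K) by (eapply Rle_trans; [apply Rabs_pos | apply (HK 0)]).
  assert (HL2 : 0 <= L ^ 2 / (2 * eta)).
  { apply Rmult_le_pos; [apply pow2_ge_0|]. apply Rlt_le, Rinv_0_lt_compat. lra. }
  (* L^2/(2 eta) serves for |y| <= 1, by the inequality between the arithmetic and geometric
     means, and 4 K for |y| >= 1. *)
  set (C := L ^ 2 / (2 * eta) + 4 * K + 1).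
  assert (HC : 0 < C) by (unfold C; lra).
  exists C. split; [exact HC|]. intros s P Hs HP.
  assert (Hu : forall y, Rabs (u y - u 0) <= eta + C * (y ^ 2 / (1 + y ^ 2))).
  { intros y. assert (Hy0 : 0 <= y ^ 2) by apply pow2_ge_0.
    destruct (Rle_dec (y ^ 2) 1) as [Hy|Hy].
    - assert (y ^ 2 / 2 <= y ^ 2 / (1 + y ^ 2)).
      { apply Rmult_le_compat_l; [assumption|]. apply Rinv_le_contravar; lra. }
      specialize (HL y 0). rewrite Rminus_0_r in HL.
      assert (L * Rabs y <= eta + L ^ 2 / (2 * eta) * (y ^ 2 / 2)).
      { assert (Ey : y ^ 2 = Rabs y ^ 2) by (symmetry; apply pow2_abs).
        rewrite Ey.
        assert (0 <= / (4 * eta) * (2 * eta - L * Rabs y) ^ 2).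
        { apply Rmult_le_pos; [apply Rlt_le, Rinv_0_lt_compat; lra | apply pow2_ge_0]. }
        replace (eta + L ^ 2 / (2 * eta) * (Rabs y ^ 2 / 2)) with
          (L * Rabs y + / (4 * eta) * (2 * eta - L * Rabs y) ^ 2) by (field; lra). lra. }
      assert (L ^ 2 / (2 * eta) * (y ^ 2 / 2) <= C * (y ^ 2 / (1 + y ^ 2))).
      { apply Rmult_le_compat; try assumption; unfold C; lra. }
      lra.
    - assert (1 / 2 <= y ^ 2 / (1 + y ^ 2)).
      { apply Rmult_le_reg_r with (1 + y ^ 2); [lra|].
        replace (y ^ 2 / (1 + y ^ 2) * (1 + y ^ 2)) with (y ^ 2) by (field; lra). lra. }
      assert (Rabs (u y - u 0) <= 2 * K).
      { unfold Rminus. eapply Rle_trans; [apply Rabs_triang|]. rewrite Rabs_Ropp.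
        assert (h1 := HK y). assert (h2 := HK 0). lra. }
      assert ((4 * K) * (1 / 2) <= C * (y ^ 2 / (1 + y ^ 2))).
      { apply Rmult_le_compat; try assumption; unfold C; lra. }
      lra. }
  assert (Hk : forall y, 0 < s / (s ^ 2 + y ^ 2)).
  { intros y. apply Rdiv_lt_0_compat; nra. }
  assert (HD : total (fun y => u y * (s / (s ^ 2 + y ^ 2)) + - u 0 * (s / (s ^ 2 + y ^ 2)))
                 (P + - u 0 * PI)).
  { apply total_plus; [exact HP|]. apply total_scal. now apply poisson_total. }
  assert (HB : total (fun y => eta * (s / (s ^ 2 + y ^ 2)) + (C * s) * / (1 + y ^ 2))
                 (eta * PI + C * s * PI)).
  { apply total_plus; apply total_scal; [now apply poisson_total | apply cauchy_total]. }
  assert (Hle : forall y, Rabs (u y * (s / (s ^ 2 + y ^ 2)) + - u 0 * (s / (s ^ 2 + y ^ 2)))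
     <= eta * (s / (s ^ 2 + y ^ 2)) + (C * s) * / (1 + y ^ 2)).
  { intros y. replace (u y * (s / (s ^ 2 + y ^ 2)) + - u 0 * (s / (s ^ 2 + y ^ 2)))
      with ((u y - u 0) * (s / (s ^ 2 + y ^ 2))) by ring.
    rewrite Rabs_mult, (Rabs_pos_eq (s / _)) by (apply Rlt_le, Hk).
    eapply Rle_trans; [apply Rmult_le_compat_r; [apply Rlt_le, Hk | apply Hu]|].
    rewrite Rmult_plus_distr_r. apply Rplus_le_compat_l.
    assert (Hy0 : 0 <= y ^ 2) by apply pow2_ge_0. assert (0 < s ^ 2) by nra.
    replace (C * (y ^ 2 / (1 + y ^ 2)) * (s / (s ^ 2 + y ^ 2))) with
      (C * s * / (1 + y ^ 2) * (y ^ 2 / (s ^ 2 + y ^ 2))) by (field; lra).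
    rewrite <- (Rmult_1_r (C * s * / (1 + y ^ 2))) at 2.
    apply Rmult_le_compat_l.
    - apply Rmult_le_pos; [nra|]. apply Rlt_le, Rinv_0_lt_compat. lra.
    - apply Rmult_le_reg_r with (s ^ 2 + y ^ 2); [lra|].
      replace (y ^ 2 / (s ^ 2 + y ^ 2) * (s ^ 2 + y ^ 2)) with (y ^ 2) by (field; lra). lra. }
  replace (P - u 0 * PI) with (P + - u 0 * PI) by ring.
  apply Rabs_le. split.
  - assert (-1 * (P + - u 0 * PI) <= eta * PI + C * s * PI); [|lra].
    apply (total_le _ _ _ _) with (2 := total_scal _ (-1) _ HD) (3 := HB).
    intros y. specialize (Hle y). apply Rabs_le_between in Hle. lra.
  - apply (total_le _ _ _ _) with (2 := HD) (3 := HB).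
    intros y. specialize (Hle y). apply Rabs_le_between in Hle. lra.
Qed.

Lemma taylor_remainder2 (g g1 g2 : R -> R) (X r M : R) :
  (forall t, is_derive g t (g1 t)) -> (forall t, is_derive g1 t (g2 t)) ->
  (forall t, Rabs (t - X) <= Rabs r -> Rabs (g2 t) <= M) ->
  Rabs (g (X + r) - g X - r * g1 X) <= M * r ^ 2.
Proof.
  intros H1 H2 HM.
  assert (Hb : forall c a, Rmin X a <= c <= Rmax X a -> Rabs (c - X) <= Rabs (a - X)).
  { intros c a. unfold Rmin, Rmax. destruct (Rle_dec X a); intros [? ?];
      unfold Rabs; destruct (Rcase_abs (c - X)), (Rcase_abs (a - X)); lra. }
  destruct (MVT_gen g X (X + r) g1) as [c [Hc Ec]].
  { intros; apply H1. }
  { intros x _. apply continuity_pt_filterlim, (ex_derive_continuous g x). now exists (g1 x). }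
  destruct (MVT_gen g1 X c g2) as [d [Hd Ed]].
  { intros; apply H2. }
  { intros x _. apply continuity_pt_filterlim, (ex_derive_continuous g1 x). now exists (g2 x). }
  apply Hb in Hc. apply Hb in Hd. replace (X + r - X) with r in * by ring.
  assert (E : g (X + r) - g X - r * g1 X = g2 d * (c - X) * r) by (rewrite <- Ed; lra).
  rewrite E, 2!Rabs_mult, <- (Rabs_pos_eq (r ^ 2)) by apply pow2_ge_0.
  rewrite <- RPow_abs. 
  assert (Hg := HM d (Rle_trans _ _ _ Hd Hc)).
  assert (p1 := Rabs_pos (g2 d)). assert (p2 := Rabs_pos (c - X)). assert (p3 := Rabs_pos r).
  simpl. rewrite Rmult_1_r, <- Rmult_assoc. apply Rmult_le_compat_r; [assumption|].
  apply Rmult_le_compat; assumption.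
Qed.

(** This is [int_0^X exp(-s xi) cos(xi y) dxi] in closed form; integrating it against [u]
    exchanges the order of integration without a Fubini theorem. *)
Definition abel_kernel (s X y : R) : R :=
  (s - exp (- s * X) * (s * cos (X * y) - y * sin (X * y))) / (s ^ 2 + y ^ 2).

Lemma Rabs_trig_le (a b t : R) : Rabs (a * cos t - b * sin t) <= Rabs a + Rabs b.
Proof.
  unfold Rminus. eapply Rle_trans; [apply Rabs_triang|].
  rewrite Rabs_Ropp, 2!Rabs_mult.
  assert (Rabs (cos t) <= 1) by (apply Rabs_le; apply COS_bound).
  assert (Rabs (sin t) <= 1) by (apply Rabs_le; apply SIN_bound).
  assert (pa := Rabs_pos a). assert (pb := Rabs_pos b). nra.
Qed.

(** The factor [exp(-sX)] makes the kernel converge to the Poisson kernel uniformly in [y];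
    this replaces the Riemann-Lebesgue lemma. *)
Lemma abel_kernel_tail (s X y : R) : 0 < s ->
  Rabs (abel_kernel s X y - s / (s ^ 2 + y ^ 2)) <= exp (- s * X) * (2 / s).
Proof.
  intros Hs. assert (Hy : 0 <= y ^ 2) by apply pow2_ge_0. assert (Hs2 : 0 < s ^ 2) by nra.
  assert (He := exp_pos (- s * X)). unfold abel_kernel.
  replace ((s - exp (- s * X) * (s * cos (X * y) - y * sin (X * y))) / (s ^ 2 + y ^ 2) -
     s / (s ^ 2 + y ^ 2)) with
    (- (exp (- s * X) * ((s * cos (X * y) - y * sin (X * y)) / (s ^ 2 + y ^ 2))))
    by (field; lra).
  rewrite Rabs_Ropp, Rabs_mult, (Rabs_pos_eq (exp _)) by lra.
  apply Rmult_le_compat_l; [lra|].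
  unfold Rdiv at 1. rewrite Rabs_mult, (Rabs_pos_eq (/ _)) by
    (apply Rlt_le, Rinv_0_lt_compat; lra).
  apply Rmult_le_reg_r with (s * (s ^ 2 + y ^ 2)); [nra|].
  replace (2 / s * (s * (s ^ 2 + y ^ 2))) with (2 * (s ^ 2 + y ^ 2)) by (field; lra).
  replace (Rabs (s * cos (X * y) - y * sin (X * y)) * / (s ^ 2 + y ^ 2) *
    (s * (s ^ 2 + y ^ 2))) with (s * Rabs (s * cos (X * y) - y * sin (X * y)))
    by (field; lra).
  assert (H := Rabs_trig_le s y (X * y)). rewrite (Rabs_pos_eq s) in H by lra.
  assert (Ey : y ^ 2 = Rabs y ^ 2) by (symmetry; apply pow2_abs).
  rewrite Ey. assert (py := Rabs_pos y).
  apply Rle_trans with (s * (s + Rabs y)); [nra|]. nra.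
Qed.

Lemma abel_kernel_remainder (s X r y : R) : 0 < s -> 0 <= X -> Rabs r <= 1 ->
  Rabs (abel_kernel s (X + r) y - abel_kernel s X y - r * (exp (- s * X) * cos (X * y)))
  <= exp s * (s + Rabs y) * r ^ 2.
Proof.
  intros Hs HX Hr.
  assert (Hy : 0 <= y ^ 2) by apply pow2_ge_0. assert (Hs2 : 0 < s ^ 2) by nra.
  apply (taylor_remainder2 (fun X => abel_kernel s X y)
    (fun X => exp (- s * X) * cos (X * y))
    (fun X => - (exp (- s * X) * (s * cos (X * y) - (- y) * sin (X * y))))).
  - intros t. unfold abel_kernel. auto_derive; [trivial|]. field. nra.
  - intros t. auto_derive; [trivial|]. ring.
  - intros t Ht. rewrite Rabs_Ropp, Rabs_mult, (Rabs_pos_eq (exp _)) by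
      apply Rlt_le, exp_pos.
    assert (H := Rabs_trig_le s (- y) (t * y)). rewrite Rabs_Ropp, (Rabs_pos_eq s) in H by lra.
    apply Rmult_le_compat; [apply Rlt_le, exp_pos | apply Rabs_pos | | exact H].
    assert (- s * t <= s).
    { assert (-1 <= t); [|nra]. assert (h := Rle_trans _ _ _ Ht Hr).
      apply Rabs_le_between in h. lra. }
    destruct H0 as [H0|H0]; [left; now apply exp_increasing | right; now rewrite H0].
Qed.

Lemma abel_kernel_continuous (s X y : R) : 0 < s -> continuous (abel_kernel s X) y.
Proof.
  intros Hs. apply (ex_derive_continuous (abel_kernel s X) y).
  unfold abel_kernel. auto_derive. assert (0 <= y * y) by nra. nra.
Qed.

Lemma decay_gain (y K : R) (a : R) : 0 <= a <= K / (1 + y ^ 2) ^ 2 ->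
  a * (1 + y ^ 2) <= K / (1 + y ^ 2).
Proof.
  intros [H0 H]. assert (Hy : 0 <= y ^ 2) by apply pow2_ge_0.
  apply Rmult_le_compat_r with (r := 1 + y ^ 2) in H; [|lra].
  replace (K / (1 + y ^ 2) ^ 2 * (1 + y ^ 2)) with (K / (1 + y ^ 2)) in H by (field; lra).
  exact H.
Qed.

Lemma exp_le (x y : R) : x <= y -> exp x <= exp y.
Proof. intros [H | ->]; [left; now apply exp_increasing | lra]. Qed.

Lemma decay_square_weaken (y K a : R) : 0 <= a <= K / (1 + y ^ 2) ^ 2 -> a <= K / (1 + y ^ 2).
Proof.
  intros H. assert (h := decay_gain y K a H). assert (h2 := pow2_ge_0 y).
  assert (0 <= a * y ^ 2) by (apply Rmult_le_pos; lra). lra.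
Qed.

Lemma decay_const_nonneg (u : R -> R) (K : R) (n : nat) :
  (forall y, Rabs (u y) <= K / (1 + y ^ 2) ^ n) -> 0 <= K.
Proof.
  intros H. specialize (H 0).
  replace (K / (1 + 0 ^ 2) ^ n) with K in H by
    (replace (1 + 0 ^ 2) with 1 by ring; rewrite pow1; field).
  eapply Rle_trans; [apply Rabs_pos | exact H].
Qed.

Lemma poisson_kernel_le (s y : R) : 0 < s -> 0 < s / (s ^ 2 + y ^ 2) <= / s.
Proof.
  intros Hs. assert (Hy0 := pow2_ge_0 y). assert (Hs2 : 0 < s ^ 2) by nra.
  split; [apply Rdiv_lt_0_compat; lra|].
  apply Rmult_le_reg_r with (s ^ 2 + y ^ 2); [lra|].
  replace (s / (s ^ 2 + y ^ 2) * (s ^ 2 + y ^ 2)) with (/ s * s ^ 2) by (field; lra).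
  apply Rmult_le_compat_l; [apply Rlt_le, Rinv_0_lt_compat|]; lra.
Qed.

Lemma abel_kernel_bound (s X y : R) : 0 < s ->
  Rabs (abel_kernel s X y) <= exp (- s * X) * (2 / s) + / s.
Proof.
  intros Hs. destruct (poisson_kernel_le s y Hs) as [h1 h2].
  replace (abel_kernel s X y) with
    (abel_kernel s X y - s / (s ^ 2 + y ^ 2) + s / (s ^ 2 + y ^ 2)) by ring.
  eapply Rle_trans; [apply Rabs_triang|]. apply Rplus_le_compat;
    [now apply abel_kernel_tail|].
  rewrite Rabs_pos_eq; lra.
Qed.

Lemma total_mult_exists (u k : R -> R) (K A : R) :
  (forall y, continuous u y) -> (forall y, Rabs (u y) <= K / (1 + y ^ 2)) ->
  (forall y, continuous k y) -> (forall y, Rabs (k y) <= A) ->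
  exists l, total (fun y => u y * k y) l.
Proof.
  intros Hu HK Hk HA. apply total_exists with (K * A).
  - intros y. now apply (continuous_mult u k).
  - intros y. rewrite Rabs_mult.
    replace (K * A / (1 + y ^ 2)) with (K / (1 + y ^ 2) * A) by (unfold Rdiv; ring).
    apply Rmult_le_compat; auto; apply Rabs_pos.
Qed.

Lemma is_derive_of_quadratic_remainder (f : R -> R) (X l C : R) : 0 <= C ->
  (forall r, Rabs r <= 1 -> Rabs (f (X + r) - f X - r * l) <= C * r ^ 2) ->
  is_derive f X l.
Proof.
  intros HC Hrem.
  apply is_derive_Reals. intros eps Heps.
  assert (Hd : 0 < Rmin 1 (eps / (C + 1))).
  { apply Rmin_pos; [lra|]. apply Rdiv_lt_0_compat; lra. }
  exists (mkposreal _ Hd). intros r Hr0 Hr. simpl in Hr.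
  assert (Hr1 := Rlt_le_trans _ _ _ Hr (Rmin_l _ _)).
  assert (Hr2 := Rlt_le_trans _ _ _ Hr (Rmin_r _ _)).
  specialize (Hrem r (Rlt_le _ _ Hr1)).
  assert (pr : 0 < Rabs r) by now apply Rabs_pos_lt.
  replace ((f (X + r) - f X) / r - l) with
    ((f (X + r) - f X - r * l) / r) by (field; assumption).
  unfold Rdiv at 1. rewrite Rabs_mult, Rabs_inv.
  apply Rmult_lt_reg_r with (Rabs r); [assumption|].
  rewrite Rmult_assoc, Rinv_l, Rmult_1_r by lra.
  replace (r ^ 2) with (Rabs r ^ 2) in Hrem by
    apply pow2_abs.
  apply Rmult_lt_compat_l with (r := C + 1) in Hr2; [|lra].
  replace ((C + 1) * (eps / (C + 1))) with eps in Hr2 by (field; lra).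
  nra.
Qed.

(** Differentiation under the integral sign.  The increment of the kernel differs from its
    linear part by [O((s + |y|) r^2)] and [u] decays fast enough to integrate this bound, so
    the remainder stays quadratic in [r] and no limit has to be exchanged. *)
Lemma abel_transform_derive (u Phi : R -> R) (K s X FX : R) : 0 < s -> 0 <= X ->
  (forall y, Rabs (u y) <= K / (1 + y ^ 2) ^ 2) ->
  (forall Z, total (fun y => u y * abel_kernel s Z y) (Phi Z)) ->
  total (fun y => u y * cos (X * y)) FX ->
  is_derive Phi X (exp (- s * X) * FX).
Proof.
  intros Hs HX hK HPhi HFX.
  assert (HKpos := decay_const_nonneg u K 2 hK). assert (Hpi := PI_RGT_0).
  assert (Hy0 : forall y, 0 <= y ^ 2) by (intros; apply pow2_ge_0).
  set (C := K * (exp s * (s + 1)) * PI).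
  assert (HC : 0 <= C).
  { unfold C. assert (h := exp_pos s). apply Rmult_le_pos; [|lra]. apply Rmult_le_pos; [lra|].
    apply Rmult_le_pos; lra. }
  assert (Hrem : forall r, Rabs r <= 1 ->
    Rabs (Phi (X + r) - Phi X - r * (exp (- s * X) * FX)) <= C * r ^ 2).
  { intros r Hr.
    replace (Phi (X + r) - Phi X - r * (exp (- s * X) * FX)) with
      (Phi (X + r) + -1 * Phi X + - (r * exp (- s * X)) * FX) by ring.
    replace (C * r ^ 2) with (K * (exp s * (s + 1)) * r ^ 2 * PI) by (unfold C; ring).
    eapply total_dominated; [|apply total_plus; [apply total_plus;
      [apply HPhi | apply total_scal, HPhi] | apply total_scal, HFX]].
    intros y. cbv beta.
    replace (u y * abel_kernel s (X + r) y + -1 * (u y * abel_kernel s X y) +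
      - (r * exp (- s * X)) * (u y * cos (X * y))) with
      (u y * (abel_kernel s (X + r) y - abel_kernel s X y -
         r * (exp (- s * X) * cos (X * y)))) by ring.
    rewrite Rabs_mult.
    assert (h1 := abel_kernel_remainder s X r y Hs HX Hr).
    assert (h2 := decay_gain y K _ (conj (Rabs_pos _) (hK y))).
    assert (Ey : y ^ 2 = Rabs y ^ 2) by (symmetry; apply pow2_abs).
    assert (h3 : exp s * (s + Rabs y) * r ^ 2 <= exp s * (s + 1) * r ^ 2 * (1 + y ^ 2)).
    { assert (s + Rabs y <= (s + 1) * (1 + y ^ 2)).
      { rewrite Ey. assert (p := Rabs_pos y). assert (q := pow2_ge_0 (Rabs y - 1 / 2)).
        assert (0 <= s * Rabs y ^ 2) by (apply Rmult_le_pos; [lra | apply pow2_ge_0]). lra. }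
      replace (exp s * (s + 1) * r ^ 2 * (1 + y ^ 2)) with
        (exp s * r ^ 2 * ((s + 1) * (1 + y ^ 2))) by ring.
      replace (exp s * (s + Rabs y) * r ^ 2) with (exp s * r ^ 2 * (s + Rabs y)) by ring.
      apply Rmult_le_compat_l; [|assumption].
      apply Rmult_le_pos; [apply Rlt_le, exp_pos | apply Hy0]. }
    apply Rle_trans with (Rabs (u y) * (exp s * (s + 1) * r ^ 2 * (1 + y ^ 2))).
    { apply Rmult_le_compat_l; [apply Rabs_pos | lra]. }
    replace (Rabs (u y) * (exp s * (s + 1) * r ^ 2 * (1 + y ^ 2))) with
      (Rabs (u y) * (1 + y ^ 2) * (exp s * (s + 1) * r ^ 2)) by ring.
    replace (K * (exp s * (s + 1)) * r ^ 2 / (1 + y ^ 2)) with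
      (K / (1 + y ^ 2) * (exp s * (s + 1) * r ^ 2)) by (field; specialize (Hy0 y); lra).
    apply Rmult_le_compat_r; [|exact h2].
    apply Rmult_le_pos; [apply Rmult_le_pos; [apply Rlt_le, exp_pos | lra] | apply Hy0]. }
  now apply is_derive_of_quadratic_remainder with C.
Qed.

(** For [Phi X = int u(y) abel_kernel s X y dy] the derivative is [exp(-sX) F X].  So [Phi] grows
    by at most [int_0^B w = Om B - Om 0] on the band and is constant beyond it, while
    [Phi X] tends to the Poisson mean. *)
Lemma poisson_mean_bound (u F w Om : R -> R) (K B b s : R)
  (hc : forall y, continuous u y)
  (hK : forall y, Rabs (u y) <= K / (1 + y ^ 2) ^ 2)
  (hF : forall xi, 0 <= xi -> total (fun y => u y * cos (xi * y)) (F xi))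
  (hB : 0 <= B < b)
  (hOm : forall xi, 0 <= xi <= B -> is_derive Om xi (w xi))
  (hw : forall xi, 0 < xi < B -> Rabs (F xi) <= w xi)
  (h0 : forall xi, B < xi -> xi <> b -> F xi = 0)
  (Hs : 0 < s) :
  exists P, total (fun y => u y * (s / (s ^ 2 + y ^ 2))) P /\ Rabs P <= Om B - Om 0.
Proof.
  assert (HKpos := decay_const_nonneg u K 2 hK). assert (Hpi := PI_RGT_0).
  assert (Hy0 : forall y, 0 <= y ^ 2) by (intros; apply pow2_ge_0).
  assert (hK1 := fun y => decay_square_weaken y K _ (conj (Rabs_pos _) (hK y))).
  destruct (total_mult_exists u (fun y => s / (s ^ 2 + y ^ 2)) K (/ s)) as [P HP]; auto.
  { intros y. apply (ex_derive_continuous (fun y => s / (s ^ 2 + y ^ 2)) y).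
    auto_derive. assert (0 <= y * y) by nra. nra. }
  { intros y. destruct (poisson_kernel_le s y Hs). rewrite Rabs_pos_eq; lra. }
  exists P. split; [exact HP|].
  set (Phi := fun X => RInt_gen (fun y => u y * abel_kernel s X y)
    (Rbar_locally m_infty) (Rbar_locally p_infty)).
  assert (HPhi : forall X, total (fun y => u y * abel_kernel s X y) (Phi X)).
  { intros X. destruct (total_mult_exists u (abel_kernel s X) K
      (exp (- s * X) * (2 / s) + / s)) as [l Hl]; auto.
    - intros y. now apply abel_kernel_continuous.
    - intros y. now apply abel_kernel_bound.
    - replace (Phi X) with l; [exact Hl|]. symmetry.
      apply (RInt_gen_total (fun y => u y * abel_kernel s X y)); [|exact Hl].
      intros y. apply (continuous_mult u (abel_kernel s X)); [apply hc|].
      now apply abel_kernel_continuous. }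
  assert (Hder : forall X, 0 <= X -> is_derive Phi X (exp (- s * X) * F X)).
  { intros X HX. apply abel_transform_derive with u K; auto. }
  assert (HX : forall X, b <= X -> Rabs (Phi X) <= Om B - Om 0).
  { intros X HbX.
    assert (E0 : Phi 0 = 0).
    { apply (total_unique _ _ _ (HPhi 0)).
      apply total_ext with (fun y => 0 * / (1 + y ^ 2)).
      - intros y. unfold abel_kernel. rewrite Rmult_0_r, !Rmult_0_l, exp_0, cos_0, sin_0.
        field. specialize (Hy0 y). nra.
      - assert (h := total_scal _ 0 _ cauchy_total). now rewrite (Rmult_0_l PI) in h. }
    assert (E1 : Rabs (Phi B - Phi 0) <= Om B - Om 0).
    { apply increment_le with (fun t => exp (- s * t) * F t) w; try lra; auto.
      - intros t Ht. apply Hder. lra.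
      - intros t Ht. rewrite Rabs_mult, (Rabs_pos_eq (exp _)) by apply Rlt_le, exp_pos.
        assert (exp (- s * t) <= 1) by (rewrite <- exp_0; apply exp_le; nra).
        specialize (hw t Ht). assert (p := Rabs_pos (F t)). nra. }
    (* The derivative of Phi vanishes off the band except perhaps at b, hence the
       separate intervals on either side of b. *)
    assert (Hflat : forall p q, B <= p <= q -> (q <= b \/ b <= p) -> Phi q = Phi p).
    { intros p q Hpq Hor.
      assert (h : Rabs (Phi q - Phi p) <= 0 - 0).
      { apply (increment_le Phi (fun _ => 0) (fun t => exp (- s * t) * F t) (fun _ => 0));
          [lra | | |].
        - intros t Ht. apply Hder. lra.
        - intros t Ht. apply (is_derive_const 0 t).
        - intros t Ht. rewrite h0, Rmult_0_r, Rabs_R0; lra. }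
      rewrite Rminus_0_r in h. assert (h' := Rabs_pos (Phi q - Phi p)).
      assert (h2 := Rle_antisym _ _ h h').
      destruct (Req_dec (Phi q - Phi p) 0) as [|n]; [lra|].
      exfalso. now apply (Rabs_no_R0 _ n). }
    rewrite E0, Rminus_0_r in E1.
    rewrite (Hflat b X), (Hflat B b); [exact E1 | lra | left; lra | lra | right; lra]. }
  apply le_epsilon. intros eps Heps.
  set (A := 2 / s * K * PI).
  assert (HA : 0 <= A).
  { unfold A. assert (0 < 2 / s) by (apply Rdiv_lt_0_compat; lra).
    apply Rmult_le_pos; [|lra]. apply Rmult_le_pos; lra. }
  (* Large enough for exp(-sX) A <= A/(1 + sX) <= eps. *)
  set (X := Rmax b (A / (s * eps))).
  assert (HbX := Rmax_l b (A / (s * eps))). fold X in HbX.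
  assert (HeX := Rmax_r b (A / (s * eps))). fold X in HeX.
  assert (Hdiff : Rabs (P + -1 * Phi X) <= exp (- s * X) * (2 / s) * K * PI).
  { eapply total_dominated; [|apply total_plus; [apply HP | apply total_scal, HPhi]].
    intros y. cbv beta.
    replace (u y * (s / (s ^ 2 + y ^ 2)) + -1 * (u y * abel_kernel s X y)) with
      (- (u y * (abel_kernel s X y - s / (s ^ 2 + y ^ 2)))) by ring.
    rewrite Rabs_Ropp, Rabs_mult.
    replace (exp (- s * X) * (2 / s) * K / (1 + y ^ 2)) with
      (K / (1 + y ^ 2) * (exp (- s * X) * (2 / s))) by (field; specialize (Hy0 y); lra).
    apply Rmult_le_compat; try apply Rabs_pos; [apply hK1 | now apply abel_kernel_tail]. }
  replace (exp (- s * X) * (2 / s) * K * PI) with (exp (- s * X) * A) in Hdiff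
    by (unfold A; ring).
  assert (exp (- s * X) * A <= eps).
  { assert (Hexp : exp (- s * X) * exp (s * X) = 1).
    { rewrite <- exp_plus, <- exp_0. f_equal. ring. }
    assert (h1 := exp_ineq1_le (s * X)).
    assert (h2 : A <= eps * (s * X)).
    { apply Rmult_le_compat_l with (r := s * eps) in HeX; [|nra].
      replace (s * eps * (A / (s * eps))) with A in HeX by (field; lra). lra. }
    assert (p := exp_pos (- s * X)).
    apply Rle_trans with (exp (- s * X) * (eps * exp (s * X))).
    - apply Rmult_le_compat_l; [lra|]. nra.
    - replace (exp (- s * X) * (eps * exp (s * X))) with
        (eps * (exp (- s * X) * exp (s * X))) by ring. rewrite Hexp. lra. }
  specialize (HX X HbX).
  replace P with (P + -1 * Phi X + Phi X) by ring.
  eapply Rle_trans; [apply Rabs_triang|]. lra.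
Qed.

(** Half of Fourier inversion, for band-limited functions: let [s] tend to [0] in
    [poisson_mean_bound].  [Om] stands for an antiderivative of the bound [w].  One frequency
    [b] outside the band may be exceptional: dividing by [4 lambda^2 - xi^2] gives no
    information at [xi = 2 lambda]. *)
Lemma sup_bound_of_cosine_transform (u F w Om : R -> R) (L K B b : R)
  (hK : forall y, Rabs (u y) <= K / (1 + y ^ 2) ^ 2)
  (hL : forall x y, Rabs (u x - u y) <= L * Rabs (x - y))
  (hF : forall xi, 0 <= xi -> total (fun y => u y * cos (xi * y)) (F xi))
  (hB : 0 <= B < b)
  (hOm : forall xi, 0 <= xi <= B -> is_derive Om xi (w xi))
  (hw : forall xi, 0 < xi < B -> Rabs (F xi) <= w xi)
  (h0 : forall xi, B < xi -> xi <> b -> F xi = 0) :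
  Rabs (u 0 * PI) <= Om B - Om 0.
Proof.
  assert (Hc := lipschitz_continuous u L hL). assert (Hpi := PI_RGT_0).
  assert (HKpos := decay_const_nonneg u K 2 hK).
  assert (hK1 := fun y => decay_square_weaken y K _ (conj (Rabs_pos _) (hK y))).
  apply le_epsilon. intros eps Heps.
  destruct (poisson_limit u L K (eps / (2 * PI)) hL) as [C [HC HCs]].
  - intros y. eapply Rle_trans; [apply hK1|]. assert (Hy0 := pow2_ge_0 y).
    apply Rmult_le_reg_r with (1 + y ^ 2); [lra|].
    replace (K / (1 + y ^ 2) * (1 + y ^ 2)) with K by (field; lra). nra.
  - apply Rdiv_lt_0_compat; lra.
  - assert (Hs : 0 < eps / (2 * PI * C)) by (apply Rdiv_lt_0_compat; nra).
    destruct (poisson_mean_bound u F w Om K B b _ Hc hK hF hB hOm hw h0 Hs) as [P [HP HPb]].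
    specialize (HCs _ P Hs HP).
    replace (eps / (2 * PI) * PI + C * (eps / (2 * PI * C)) * PI) with eps in HCs
      by (field; lra).
    replace (u 0 * PI) with (P - (P - u 0 * PI)) by ring.
    unfold Rminus at 1. eapply Rle_trans; [apply Rabs_triang|]. rewrite Rabs_Ropp. lra.
Qed.

(** * Complex integrals and the Fourier transform *)

Definition Ctotal (f : R -> C) (l : C) : Prop :=
  total (fun y => Re (f y)) (Re l) /\ total (fun y => Im (f y)) (Im l).

Lemma Ctotal_ext (f g : R -> C) (l : C) :
  (forall x, f x = g x) -> Ctotal f l -> Ctotal g l.
Proof.
  intros H [H1 H2]. split; [apply (total_ext (fun y => Re (f y))) |
    apply (total_ext (fun y => Im (f y)))]; auto; intros; now rewrite H.
Qed.

Lemma Ctotal_plus (f g : R -> C) (a b : C) :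
  Ctotal f a -> Ctotal g b -> Ctotal (fun x => f x + g x)%C (a + b)%C.
Proof.
  intros [F1 F2] [G1 G2]. split.
  - apply (total_plus _ _ _ _ F1 G1).
  - apply (total_plus _ _ _ _ F2 G2).
Qed.

Lemma Ctotal_scal (f : R -> C) (c a : C) :
  Ctotal f a -> Ctotal (fun x => c * f x)%C (c * a)%C.
Proof.
  intros [F1 F2]. split.
  - rewrite re_mult.
    apply (total_ext (fun x => Re c * Re (f x) + - Im c * Im (f x))).
    + intros x. rewrite re_mult. ring.
    + replace (Re c * Re a - Im c * Im a) with (Re c * Re a + - Im c * Im a) by ring.
      apply total_plus; now apply total_scal.
  - rewrite im_mult.
    apply (total_ext (fun x => Re c * Im (f x) + Im c * Re (f x))).
    + intros x. rewrite im_mult. ring.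
    + apply total_plus; now apply total_scal.
Qed.

Lemma Ctotal_shift (f : R -> C) (d : R) (l : C) :
  Ctotal f l -> Ctotal (fun y => f (y + d)) l.
Proof.
  intros [H1 H2]. split.
  - apply (total_shift (fun y => Re (f y)) d _ H1).
  - apply (total_shift (fun y => Im (f y)) d _ H2).
Qed.

Lemma Ctotal_unique (f : R -> C) (a b : C) : Ctotal f a -> Ctotal f b -> a = b.
Proof.
  intros [A1 A2] [B1 B2]. destruct a as [a1 a2], b as [b1 b2]. simpl in *.
  f_equal; eapply total_unique; eassumption.
Qed.

Lemma im_le_Cmod (z : C) : Rabs (Im z) <= Cmod z.
Proof. eapply Rle_trans; [apply Rmax_r | apply Rmax_Cmod]. Qed.

Lemma Cmod_le_Re_Im (z : C) : Cmod z <= Rabs (Re z) + Rabs (Im z).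
Proof.
  destruct z as [a b]. simpl Re. simpl Im.
  replace ((a, b) : C) with (RtoC a + Ci * RtoC b)%C by
    (unfold Ci, RtoC, Cmult, Cplus; simpl; f_equal; ring).
  eapply Rle_trans; [apply Cmod_triangle|]. rewrite Cmod_mult, Cmod_Ci, !Cmod_R. lra.
Qed.

(** Multiplying by a suitable unit reduces norm estimates of complex quantities to real
    ones. *)
Lemma exists_phase (z : C) : exists c, Cmod c = 1 /\ Re (c * z)%C = Cmod z.
Proof.
  destruct (Req_dec (Cmod z) 0) as [H|H].
  - exists (RtoC 1). split; [apply Cmod_1|]. rewrite H.
    apply Cmod_eq_0 in H. subst. simpl. ring.
  - exists (Cconj z / RtoC (Cmod z))%C.
    assert (p := Cmod_ge_0 z).
    assert (HR : RtoC (Cmod z) <> 0%C) by (intros E; apply H; now apply RtoC_inj).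
    split.
    + rewrite Cmod_div by assumption. rewrite Cmod_conj, Cmod_R, Rabs_pos_eq by assumption.
      field. assumption.
    + replace (Cconj z / RtoC (Cmod z) * z)%C with (z * Cconj z / RtoC (Cmod z))%C
        by (field; assumption).
      rewrite <- Cmod2_conj, <- RtoC_div by assumption. simpl. field. assumption.
Qed.

Lemma Cmod_phase (c z : C) : Cmod c = 1 -> Rabs (Re (c * z)%C) <= Cmod z.
Proof.
  intros H. eapply Rle_trans; [apply re_le_Cmod|]. rewrite Cmod_mult, H. lra.
Qed.

Lemma expi_plus (a b : R) : (expi a * expi b)%C = expi (a + b).
Proof.
  unfold expi, Cmult; simpl. rewrite cos_plus, sin_plus. f_equal; ring.
Qed.

Lemma Cmod_expi (a : R) : Cmod (expi a) = 1.
Proof.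
  unfold Cmod, expi; simpl fst; simpl snd.
  replace (cos a ^ 2 + sin a ^ 2) with 1; [apply sqrt_1|].
  assert (h := sin2_cos2 a). unfold Rsqr in h. lra.
Qed.

Lemma expi_cos (a : R) : (expi a + expi (- a))%C = RtoC (2 * cos a).
Proof.
  unfold expi, Cplus, RtoC; simpl. rewrite cos_neg, sin_neg. f_equal; ring.
Qed.

Lemma Cmod_inv_2 : Cmod (/ 2)%C = / 2.
Proof.
  rewrite Cmod_inv by (intros E; apply RtoC_inj in E; lra).
  rewrite Cmod_R, Rabs_pos_eq; lra.
Qed.

(** Enough regularity for the sup bound, and stable under translations and differences,
    which lets the iterates of [half_diff] stay in the class. *)
Definition tame (f : R -> C) : Prop :=
  exists L K : R,
    (forall x y, Cmod (f x - f y) <= L * Rabs (x - y)) /\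
    (forall y, Cmod (f y) <= K / (1 + y ^ 2) ^ 2).

Lemma one_plus_sq_pos (y : R) : 0 < 1 + y ^ 2.
Proof. assert (h := pow2_ge_0 y). lra. Qed.

Lemma continuous_expi_mult (f : R -> C) (xi x : R) :
  continuous (fun y => Re (f y)) x -> continuous (fun y => Im (f y)) x ->
  continuous (fun y => Re (expi (- (y * xi)) * f y)%C) x /\
  continuous (fun y => Im (expi (- (y * xi)) * f y)%C) x.
Proof.
  intros H1 H2.
  assert (Cc : continuous (fun y => cos (- (y * xi))) x).
  { apply (ex_derive_continuous (fun y => cos (- (y * xi))) x). auto_derive. trivial. }
  assert (Cs : continuous (fun y => sin (- (y * xi))) x).
  { apply (ex_derive_continuous (fun y => sin (- (y * xi))) x). auto_derive. trivial. }
  split.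
  - apply (continuous_minus (fun y => cos (- (y * xi)) * Re (f y))
      (fun y => sin (- (y * xi)) * Im (f y)));
    [ apply (continuous_mult (fun y => cos (- (y * xi))) (fun y => Re (f y)))
    | apply (continuous_mult (fun y => sin (- (y * xi))) (fun y => Im (f y)))]; assumption.
  - apply (continuous_plus (fun y => cos (- (y * xi)) * Im (f y))
      (fun y => sin (- (y * xi)) * Re (f y)));
    [ apply (continuous_mult (fun y => cos (- (y * xi))) (fun y => Im (f y)))
    | apply (continuous_mult (fun y => sin (- (y * xi))) (fun y => Re (f y)))]; assumption.
Qed.

Lemma fourier_total_of_bound (f : R -> C) (K xi : R) :
  (forall x, continuous (fun y => Re (f y)) x) ->
  (forall x, continuous (fun y => Im (f y)) x) ->
  (forall y, Cmod (f y) <= K / (1 + y ^ 2)) ->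
  Ctotal (fun y => expi (- (y * xi)) * f y)%C (fourier f xi).
Proof.
  intros H1 H2 HK.
  assert (C1 := fun x => proj1 (continuous_expi_mult f xi x (H1 x) (H2 x))).
  assert (C2 := fun x => proj2 (continuous_expi_mult f xi x (H1 x) (H2 x))).
  assert (HB : forall y, Cmod (expi (- (y * xi)) * f y)%C <= K / (1 + y ^ 2)).
  { intros y. rewrite Cmod_mult, Cmod_expi, Rmult_1_l. apply HK. }
  destruct (total_exists _ K C1) as [l1 Hl1].
  { intros y. eapply Rle_trans; [apply re_le_Cmod | apply HB]. }
  destruct (total_exists _ K C2) as [l2 Hl2].
  { intros y. eapply Rle_trans; [apply im_le_Cmod | apply HB]. }
  assert (E1 := RInt_gen_total _ _ C1 Hl1). assert (E2 := RInt_gen_total _ _ C2 Hl2).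
  split.
  - rewrite <- E1 in Hl1. exact Hl1.
  - rewrite <- E2 in Hl2. exact Hl2.
Qed.

Lemma tame_continuous (f : R -> C) : tame f ->
  (forall x, continuous (fun y => Re (f y)) x) /\
  (forall x, continuous (fun y => Im (f y)) x).
Proof.
  intros [L [K [HL _]]]. split; apply lipschitz_continuous with L; intros x y.
  - change (Rabs (Re (f x - f y)%C) <= L * Rabs (x - y)).
    eapply Rle_trans; [apply re_le_Cmod | apply HL].
  - change (Rabs (Im (f x - f y)%C) <= L * Rabs (x - y)).
    eapply Rle_trans; [apply im_le_Cmod | apply HL].
Qed.

Lemma fourier_total (f : R -> C) (xi : R) : tame f ->
  Ctotal (fun y => expi (- (y * xi)) * f y)%C (fourier f xi).
Proof.
  intros H. destruct (tame_continuous f H) as [C1 C2]. destruct H as [L [K [HL HK]]].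
  apply fourier_total_of_bound with K; try assumption.
  intros y. apply decay_square_weaken. split; [apply Cmod_ge_0 | apply HK].
Qed.

(** Peetre's inequality [1 + y^2 <= 2 (1 + d^2) (1 + (y + d)^2)]. *)
Lemma decay_shift (f : R -> C) (K d : R) :
  (forall y, Cmod (f y) <= K / (1 + y ^ 2) ^ 2) ->
  forall y, Cmod (f (y + d)) <= (K * (2 * (1 + d ^ 2)) ^ 2) / (1 + y ^ 2) ^ 2.
Proof.
  intros H y. eapply Rle_trans; [apply H|].
  assert (HK : 0 <= K).
  { specialize (H 0). replace (K / (1 + 0 ^ 2) ^ 2) with K in H by field.
    eapply Rle_trans; [apply Cmod_ge_0 | exact H]. }
  unfold Rdiv. rewrite Rmult_assoc. apply Rmult_le_compat_l; [exact HK|].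
  assert (p1 := one_plus_sq_pos y). assert (p2 := one_plus_sq_pos (y + d)).
  assert (p3 := one_plus_sq_pos d).
  assert (E : 1 + y ^ 2 <= 2 * (1 + d ^ 2) * (1 + (y + d) ^ 2)).
  { assert (h1 := pow2_ge_0 (y + 2 * d)). assert (h2 := pow2_ge_0 (d * (y + d))). nra. }
  apply Rmult_le_reg_r with ((1 + y ^ 2) ^ 2 * (1 + (y + d) ^ 2) ^ 2).
  { apply Rmult_lt_0_compat; apply pow_lt; assumption. }
  replace (/ (1 + (y + d) ^ 2) ^ 2 * ((1 + y ^ 2) ^ 2 * (1 + (y + d) ^ 2) ^ 2)) with
    ((1 + y ^ 2) ^ 2) by (field; lra).
  replace ((2 * (1 + d ^ 2)) ^ 2 * / (1 + y ^ 2) ^ 2 *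
    ((1 + y ^ 2) ^ 2 * (1 + (y + d) ^ 2) ^ 2)) with
    ((2 * (1 + d ^ 2) * (1 + (y + d) ^ 2)) ^ 2) by (field; lra).
  apply pow_incr. lra.
Qed.

(** Apply [sup_bound_of_cosine_transform] to [u(y) = Re (c f(x + y))], where the unit [c]
    makes [u(0) = |f(x)|]: translation and phase do not change the modulus of the transform. *)
Lemma fourier_sup_bound (f : R -> C) (w Om : R -> R) (B b : R) :
  tame f -> 0 <= B < b ->
  (forall xi, 0 <= xi <= B -> is_derive Om xi (w xi)) ->
  (forall xi, Rabs xi <= B -> Cmod (fourier f xi) <= w (Rabs xi)) ->
  (forall xi, Rabs xi > B -> Rabs xi <> b -> fourier f xi = RtoC 0) ->
  forall x, Cmod (f x) * PI <= Om B - Om 0.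
Proof.
  intros Hf HB HOm Hw H0 x.
  assert (Htot := fun xi => fourier_total f xi Hf).
  destruct Hf as [L [K [HL HK]]].
  destruct (exists_phase (f x)) as [c [Hc1 Hc2]].
  set (F := fun xi => Re ((c * / 2 * expi (x * xi)) * fourier f xi +
                          (c * / 2 * expi (- (x * xi))) * fourier f (- xi))%C).
  assert (HF : forall xi, Rabs (F xi) <= (Cmod (fourier f xi) + Cmod (fourier f (- xi))) / 2).
  { intros xi. unfold F. eapply Rle_trans; [apply re_le_Cmod|].
    eapply Rle_trans; [apply Cmod_triangle|].
    rewrite !Cmod_mult, !Cmod_expi, Hc1.
    rewrite Cmod_inv_2. lra. }
  replace (Cmod (f x) * PI) with (Rabs (Re (c * f (0 + x)%R)%C * PI)).
  2: { rewrite Rplus_0_l, Hc2. apply Rabs_pos_eq.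
       apply Rmult_le_pos; [apply Cmod_ge_0 | apply Rlt_le, PI_RGT_0]. }
  apply (sup_bound_of_cosine_transform (fun y => Re (c * f (y + x)%R)%C) F w Om L
    (K * (2 * (1 + x ^ 2)) ^ 2) B b); try assumption.
  - intros y. eapply Rle_trans; [now apply Cmod_phase|]. now apply decay_shift.
  - intros y z. 
    replace (Re (c * f (y + x)%R)%C - Re (c * f (z + x)%R)%C) with
      (Re (c * (f (y + x)%R - f (z + x)%R))%C) by
      (rewrite !re_mult; unfold Re, Im; simpl; ring).
    eapply Rle_trans; [now apply Cmod_phase|].
    replace (y - z) with (y + x - (z + x)) by ring. apply HL.
  - intros xi _.
    assert (T := Ctotal_plus _ _ _ _
      (Ctotal_scal _ (c * / 2 * expi (x * xi))%C _ (Ctotal_shift _ x _ (Htot xi)))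
      (Ctotal_scal _ (c * / 2 * expi (- (x * xi)))%C _ (Ctotal_shift _ x _ (Htot (- xi))))).
    destruct T as [T _]. revert T. apply total_ext. intros y. cbv beta.
    replace (c * / 2 * expi (x * xi) * (expi (- ((y + x) * xi)) * f (y + x)%R) +
      c * / 2 * expi (- (x * xi)) * (expi (- ((y + x) * - xi)) * f (y + x)%R))%C with
      (RtoC (cos (xi * y)) * (c * f (y + x)%R))%C.
    + rewrite re_scal_l. ring.
    + replace (c * / 2 * expi (x * xi) * (expi (- ((y + x) * xi)) * f (y + x)%R) +
        c * / 2 * expi (- (x * xi)) * (expi (- ((y + x) * - xi)) * f (y + x)%R))%C with
        (c * / 2 * f (y + x)%R * (expi (x * xi) * expi (- ((y + x) * xi)) +
         expi (- (x * xi)) * expi (- ((y + x) * - xi))))%C by ring.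
      rewrite 2!expi_plus.
      replace (x * xi + - ((y + x) * xi)) with (- (xi * y)) by ring.
      replace (- (x * xi) + - ((y + x) * - xi)) with (- - (xi * y)) by ring.
      rewrite expi_cos, cos_neg, RtoC_mult. field.
  - intros xi Hxi. eapply Rle_trans; [apply HF|].
    assert (h1 := Hw xi). assert (h2 := Hw (- xi)).
    rewrite Rabs_Ropp in h2. rewrite Rabs_pos_eq in h1, h2 by lra. lra.
  - intros xi Hxi Hne. unfold F.
    rewrite 2!H0; rewrite ?Rabs_Ropp, ?Rabs_pos_eq; try lra. simpl. ring.
Qed.

(** * The half-period difference *)

Definition half_diff (h : R) (f : R -> C) (x : R) : C := ((f x - f (x - h)%R) / 2)%C.

Lemma Cmod_half (z w : C) : Cmod ((z - w) / 2)%C <= (Cmod z + Cmod w) / 2.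
Proof.
  unfold Cdiv. rewrite Cmod_mult, Cmod_inv_2.
  assert (h : Cmod (z - w)%C <= Cmod z + Cmod w).
  { unfold Cminus. eapply Rle_trans; [apply Cmod_triangle|]. rewrite Cmod_opp. lra. }
  lra.
Qed.

Lemma tame_half_diff (h : R) (f : R -> C) : tame f -> tame (half_diff h f).
Proof.
  intros [L [K [HL HK]]].
  exists L, ((K + K * (2 * (1 + (- h) ^ 2)) ^ 2) / 2). split.
  - intros x y. unfold half_diff.
    replace ((f x - f (x - h)%R) / 2 - (f y - f (y - h)%R) / 2)%C with
      (((f x - f y) - (f (x - h)%R - f (y - h)%R)) / 2)%C by field.
    eapply Rle_trans; [apply Cmod_half|].
    assert (h1 := HL x y). assert (h2 := HL (x - h) (y - h)).
    replace (x - h - (y - h)) with (x - y) in h2 by ring. lra.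
  - intros y. unfold half_diff. eapply Rle_trans; [apply Cmod_half|].
    assert (h1 := HK y). assert (h2 := decay_shift f K (- h) HK y).
    unfold Rminus. unfold Rdiv in *. lra.
Qed.

Lemma fourier_half_diff (h : R) (f : R -> C) (xi : R) : tame f ->
  fourier (half_diff h f) xi = ((1 - expi (- (h * xi))) / 2 * fourier f xi)%C.
Proof.
  intros Hf. apply (Ctotal_unique (fun y => expi (- (y * xi)) * half_diff h f y)%C).
  { apply fourier_total. now apply tame_half_diff. }
  replace ((1 - expi (- (h * xi))) / 2 * fourier f xi)%C with
    (/ 2 * fourier f xi + - / 2 * expi (- (h * xi)) * fourier f xi)%C by field.
  apply Ctotal_ext with (fun y => / 2 * (expi (- (y * xi)) * f y) +
    - / 2 * expi (- (h * xi)) * (expi (- ((y + - h) * xi)) * f (y + - h)%R))%C.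
  - intros y. unfold half_diff, Rminus at 1.
    replace (expi (- (y * xi))) with (expi (- (h * xi)) * expi (- ((y + - h) * xi)))%C.
    + field.
    + rewrite expi_plus. f_equal. ring.
  - apply Ctotal_plus; apply Ctotal_scal.
    + now apply fourier_total.
    + apply (Ctotal_shift (fun y => expi (- (y * xi)) * f y)%C). now apply fourier_total.
Qed.

(** [1 - exp(-2it) = 2i exp(-it) sin t]. *)
Lemma Cmod_half_diff_symbol (t : R) : Cmod ((1 - expi (- (2 * t))) / 2)%C = Rabs (sin t).
Proof.
  replace ((1 - expi (- (2 * t))) / 2)%C with ((Ci * expi (- t)) * RtoC (sin t))%C.
  - rewrite !Cmod_mult, Cmod_Ci, Cmod_expi, Cmod_R. ring.
  - unfold expi, Ci, RtoC, Cdiv, Cinv, Cminus, Copp, Cplus, Cmult; simpl.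
    rewrite !cos_neg, !sin_neg, cos_2a_sin, sin_2a. f_equal; field.
Qed.

Lemma Cmod_fourier_iter_half_diff (h : R) (f : R -> C) (n : nat) (xi : R) : tame f ->
  tame (Nat.iter n (half_diff h) f) /\
  Cmod (fourier (Nat.iter n (half_diff h) f) xi) =
    Rabs (sin (h * xi / 2)) ^ n * Cmod (fourier f xi).
Proof.
  intros Hf. induction n as [|n [IH1 IH2]].
  - split; [exact Hf | simpl; ring].
  - split; [now apply tame_half_diff|].
    simpl Nat.iter. rewrite fourier_half_diff, Cmod_mult, IH2 by assumption.
    replace (h * xi) with (2 * (h * xi / 2)) at 1 by field.
    rewrite Cmod_half_diff_symbol. simpl. ring.
Qed.

(** Because [R] is an average of two values with weights of modulus [1/2], errors are not
    amplified: each of the [n] steps adds at most the size of [f - R f], which is half of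
    [f(y) + f(y - h)]. Only points to the left of [x] are used, as [h >= 0]. *)
Lemma iter_half_diff_close (h kappa x : R) (f : R -> C) (n : nat) : 0 <= h ->
  (forall y, y <= x -> Cmod (f y + f (y - h)%R)%C <= kappa) ->
  forall y, y <= x -> Cmod (f y - Nat.iter n (half_diff h) f y)%C <= INR n * (kappa / 2).
Proof.
  intros Hh Hk. induction n as [|n IH]; intros y Hy.
  - simpl. replace (f y - f y)%C with (RtoC 0) by ring. rewrite Cmod_0. lra.
  - rewrite S_INR. simpl Nat.iter. unfold half_diff at 1.
    set (g := Nat.iter n (half_diff h) f) in *.
    replace (f y - (g y - g (y - h)%R) / 2)%C with
      ((f y + f (y - h)%R - 0) / 2 + ((f y - g y) - (f (y - h)%R - g (y - h)%R)) / 2)%C by field.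
    eapply Rle_trans; [apply Cmod_triangle|].
    assert (h1 := Cmod_half (f y + f (y - h)%R)%C 0). rewrite Cmod_0 in h1.
    assert (h2 := Cmod_half (f y - g y)%C (f (y - h)%R - g (y - h)%R)%C).
    assert (h3 := Hk y Hy). assert (h4 := IH y Hy). assert (h5 := IH (y - h)).
    specialize (h5 ltac:(lra)). lra.
Qed.

(** * Calculus of complex-valued functions *)

Definition is_Cderive (f : R -> C) (x : R) (l : C) : Prop :=
  is_derive (fun y => Re (f y)) x (Re l) /\ is_derive (fun y => Im (f y)) x (Im l).

Lemma is_derive_eq (f : R -> R) (x a b : R) : is_derive f x a -> a = b -> is_derive f x b.
Proof. now intros H <-. Qed.

Lemma is_Cderive_ext (f g : R -> C) (x : R) (a b : C) :
  (forall y, f y = g y) -> a = b -> is_Cderive f x a -> is_Cderive g x b.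
Proof.
  intros H <- [H1 H2].
  split; [apply (is_derive_ext (fun y => Re (f y))) | apply (is_derive_ext (fun y => Im (f y)))];
    auto; intros; now rewrite H.
Qed.

Lemma is_Cderive_plus (f g : R -> C) (x : R) (a b : C) :
  is_Cderive f x a -> is_Cderive g x b -> is_Cderive (fun y => f y + g y)%C x (a + b)%C.
Proof.
  intros [F1 F2] [G1 G2]. split.
  - apply (is_derive_plus (fun y => Re (f y)) (fun y => Re (g y)) _ _ _ F1 G1).
  - apply (is_derive_plus (fun y => Im (f y)) (fun y => Im (g y)) _ _ _ F2 G2).
Qed.

Lemma is_derive_Rmult (f g : R -> R) (x a b : R) :
  is_derive f x a -> is_derive g x b -> is_derive (fun y => f y * g y) x (a * g x + f x * b).
Proof. intros Hf Hg. apply (is_derive_mult f g x a b Hf Hg Rmult_comm). Qed.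

Lemma is_Cderive_mult (f g : R -> C) (x : R) (a b : C) :
  is_Cderive f x a -> is_Cderive g x b ->
  is_Cderive (fun y => f y * g y)%C x (a * g x + f x * b)%C.
Proof.
  intros [F1 F2] [G1 G2]. split.
  - eapply is_derive_eq; [apply (is_derive_minus (fun y => Re (f y) * Re (g y))
      (fun y => Im (f y) * Im (g y)));
      apply is_derive_Rmult; eassumption|].
    rewrite re_plus, 2!re_mult. unfold minus, plus, opp; simpl. ring.
  - eapply is_derive_eq; [apply (is_derive_plus (fun y => Re (f y) * Im (g y))
      (fun y => Im (f y) * Re (g y)));
      apply is_derive_Rmult; eassumption|].
    change (Im (a * g x + f x * b)%C) with (Im (a * g x)%C + Im (f x * b)%C).
    rewrite 2!im_mult. unfold plus; simpl. ring.
Qed.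

Lemma is_Cderive_RtoC (u : R -> R) (x a : R) :
  is_derive u x a -> is_Cderive (fun y => RtoC (u y)) x (RtoC a).
Proof. intros H. split; [exact H | apply (is_derive_const 0 x)]. Qed.

Lemma is_Cderive_const (c : C) (x : R) : is_Cderive (fun _ => c) x 0%C.
Proof. split; [apply (is_derive_const (Re c) x) | apply (is_derive_const (Im c) x)]. Qed.

Lemma is_Cderive_expi (c x : R) :
  is_Cderive (fun y => expi (- (y * c))) x (- (Ci * c * expi (- (x * c))))%C.
Proof.
  split; simpl; auto_derive; trivial; unfold expi; simpl; ring.
Qed.

Lemma Cmod_increment (f d : R -> C) (a b kappa : R) : a <= b ->
  (forall t, a <= t <= b -> is_Cderive f t (d t)) ->
  (forall t, a <= t <= b -> Cmod (d t) <= kappa) ->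
  Cmod (f b - f a)%C <= kappa * (b - a).
Proof.
  intros Hab Hd Hk. destruct (exists_phase (f b - f a)%C) as [c [Hc1 Hc2]].
  rewrite <- Hc2.
  assert (h : Rabs (Re (c * f b)%C - Re (c * f a)%C) <= kappa * b - kappa * a).
  { apply (increment_le (fun t => Re (c * f t)%C) (fun t => kappa * t)
      (fun t => Re (0 * f t + c * d t)%C) (fun _ => kappa)); auto.
    - intros t Ht.
      apply (is_Cderive_mult (fun _ => c) f t); [apply is_Cderive_const | now apply Hd].
    - intros t Ht. auto_derive; [trivial | ring].
    - intros t Ht. replace (0 * f t + c * d t)%C with (c * d t)%C by ring.
      eapply Rle_trans; [now apply Cmod_phase|]. apply Hk. lra. }
  replace (Re (c * (f b - f a))%C) with (Re (c * f b)%C - Re (c * f a)%C) by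
    (rewrite !re_mult; unfold Re, Im; simpl; ring).
  apply Rabs_le_between in h. lra.
Qed.

Lemma Cmod_lipschitz (f d : R -> C) (kappa : R) :
  (forall t, is_Cderive f t (d t)) -> (forall t, Cmod (d t) <= kappa) ->
  forall x y, Cmod (f x - f y)%C <= kappa * Rabs (x - y).
Proof.
  intros Hd Hk x y. destruct (Rle_dec x y) as [h|h].
  - replace (f x - f y)%C with (- (f y - f x))%C by ring.
    rewrite Cmod_opp, Rabs_minus_sym, Rabs_pos_eq by lra. apply Cmod_increment with d; auto.
  - rewrite Rabs_pos_eq by lra. apply Cmod_increment with d; auto; lra.
Qed.

Lemma decay_lim (F : R -> R) (K : R) (x : Rbar) (hx : x = p_infty \/ x = m_infty) :
  (forall y, Rabs (F y) <= K / (1 + y ^ 2)) -> is_lim F x 0.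
Proof.
  intros H.
  assert (HK : 0 <= K).
  { specialize (H 0). replace (K / (1 + 0 ^ 2)) with K in H by field.
    eapply Rle_trans; [apply Rabs_pos | exact H]. }
  apply is_lim_spec. intros eps. assert (He := cond_pos eps).
  assert (Hy : forall y, K / eps < Rabs y -> Rabs (F y - 0) < eps).
  { intros y Hy. rewrite Rminus_0_r. eapply Rle_lt_trans; [apply H|].
    assert (p := one_plus_sq_pos y).
    apply Rmult_lt_reg_r with (1 + y ^ 2); [assumption|].
    replace (K / (1 + y ^ 2) * (1 + y ^ 2)) with K by (field; lra).
    apply Rmult_lt_compat_l with (r := eps) in Hy; [|assumption].
    replace (eps * (K / eps)) with K in Hy by (field; lra).
    eapply Rlt_le_trans; [exact Hy|]. apply Rmult_le_compat_l; [lra|].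
    rewrite <- (pow2_abs y). assert (h := pow2_ge_0 (Rabs y - 1)).
    assert (q := Rabs_pos y). lra. }
  destruct hx as [-> | ->].
  - exists (K / eps). intros y h. apply Hy. eapply Rlt_le_trans; [exact h | apply Rle_abs].
  - exists (- (K / eps)). intros y h. apply Hy. rewrite <- Rabs_Ropp.
    eapply Rlt_le_trans; [|apply Rle_abs]. lra.
Qed.

Lemma Ctotal_of_decaying_antiderivative (F g : R -> C) (K : R) :
  (forall x, is_Cderive F x (g x)) -> (forall y, Cmod (F y) <= K / (1 + y ^ 2)) ->
  Ctotal g 0.
Proof.
  intros Hd HK.
  assert (H1 : forall y, Rabs (Re (F y)) <= K / (1 + y ^ 2)).
  { intros y. eapply Rle_trans; [apply re_le_Cmod | apply HK]. }
  assert (H2 : forall y, Rabs (Im (F y)) <= K / (1 + y ^ 2)).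
  { intros y. eapply Rle_trans; [apply im_le_Cmod | apply HK]. }
  split; simpl.
  - exists (fun y => Re (F y)). split; [intros x; apply Hd|].
    split; apply decay_lim with K; auto.
  - exists (fun y => Im (F y)). split; [intros x; apply Hd|].
    split; apply decay_lim with K; auto.
Qed.

(** Integration by parts.  The conclusion is an integral rather than a value of [fourier],
    so that the convergence of the left-hand side is part of the result. *)
Lemma fourier_derivative (f f1 : R -> C) (xi : R) : tame f ->
  (forall x, is_Cderive f x (f1 x)) ->
  Ctotal (fun y => expi (- (y * xi)) * f1 y)%C (Ci * xi * fourier f xi)%C.
Proof.
  intros Hf Hd.
  apply Ctotal_ext with (fun y =>
    (- (Ci * xi * expi (- (y * xi))) * f y + expi (- (y * xi)) * f1 y) +
    Ci * xi * (expi (- (y * xi)) * f y))%C; [intros; ring|].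
  replace (Ci * xi * fourier f xi)%C with (0 + Ci * xi * fourier f xi)%C by ring.
  apply Ctotal_plus; [|now apply Ctotal_scal, fourier_total].
  destruct Hf as [L [K [_ HK]]].
  apply (Ctotal_of_decaying_antiderivative (fun y => expi (- (y * xi)) * f y)%C _ K).
  - intros x. apply (is_Cderive_mult (fun y => expi (- (y * xi))) f);
      [apply is_Cderive_expi | apply Hd].
  - intros y. rewrite Cmod_mult, Cmod_expi, Rmult_1_l. apply decay_square_weaken.
    split; [apply Cmod_ge_0 | apply HK].
Qed.

Lemma increment_to_limit (G : R -> R) (x D : R) (p : Rbar) :
  is_lim G p 0 -> Rbar_locally' p (fun a => Rabs (G x - G a) <= D) -> Rabs (G x) <= D.
Proof.
  intros HG H.
  assert (HL : is_lim (fun a => G x + -1 * G a) p (G x + -1 * 0)).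
  { apply is_lim_add; [apply is_lim_const | now apply is_lim_cmul]. }
  replace (G x + -1 * 0) with (G x) in HL by ring.
  apply Rabs_le. split.
  - apply (is_lim_ge_const _ _ _ _ HL). revert H. apply filter_imp.
    intros a Ha. apply Rabs_le_between in Ha. lra.
  - apply (is_lim_le_const _ _ _ _ HL). revert H. apply filter_imp.
    intros a Ha. apply Rabs_le_between in Ha. lra.
Qed.

(** Beyond [|x|] the integrand is at most [K (1+x^2)^-2 (1+y^2)^-1]; integrate from the
    nearer infinity, where [G] vanishes. *)
Lemma antiderivative_decay (g G : R -> R) (K : R) :
  (forall y, Rabs (g y) <= K / (1 + y ^ 2) ^ 3) ->
  (forall x, is_derive G x (g x)) -> is_lim G m_infty 0 -> is_lim G p_infty 0 ->
  forall x, Rabs (G x) <= (K * PI) / (1 + x ^ 2) ^ 2.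
Proof.
  intros HK Hd Hm Hp x.
  assert (K0 : 0 <= K).
  { specialize (HK 0). replace (K / (1 + 0 ^ 2) ^ 3) with K in HK by field.
    eapply Rle_trans; [apply Rabs_pos | exact HK]. }
  assert (px := one_plus_sq_pos x).
  set (C := K / (1 + x ^ 2) ^ 2).
  assert (C0 : 0 <= C).
  { unfold C. apply Rmult_le_pos; [assumption|]. apply Rlt_le, Rinv_0_lt_compat, pow_lt. lra. }
  replace (K * PI / (1 + x ^ 2) ^ 2) with (C * PI) by (unfold C; field; lra).
  assert (Hb : forall t, x ^ 2 <= t ^ 2 -> Rabs (g t) <= C * / (1 + t ^ 2)).
  { intros t Ht. eapply Rle_trans; [apply HK|]. assert (pt := one_plus_sq_pos t).
    replace (K / (1 + t ^ 2) ^ 3) with (K / (1 + t ^ 2) ^ 2 * / (1 + t ^ 2)) by (field; lra).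
    apply Rmult_le_compat_r; [apply Rlt_le, Rinv_0_lt_compat; lra|].
    apply Rmult_le_compat_l; [assumption|]. apply Rinv_le_contravar.
    - apply pow_lt; lra.
    - apply pow_incr; lra. }
  assert (Hat : forall t, is_derive (fun y => C * atan y) t (C * / (1 + t ^ 2))).
  { intros t. apply (is_derive_scal atan t C). replace (t ^ 2) with (Rsqr t) by (unfold Rsqr; ring).
    apply is_derive_atan. }
  assert (Hbd : forall a b, C * atan b - C * atan a <= C * PI).
  { intros a b. assert (h1 := atan_bound a). assert (h2 := atan_bound b). nra. }
  destruct (Rle_dec x 0) as [Hx|Hx].
  - apply increment_to_limit with m_infty; [exact Hm|]. exists x. intros a Ha.
    eapply Rle_trans; [|apply (Hbd a x)].
    apply (increment_le G (fun t => C * atan t) g (fun t => C * / (1 + t ^ 2))); auto; [lra|].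
    intros t Ht. apply Hb. nra.
  - apply increment_to_limit with p_infty; [exact Hp|]. exists x. intros a Ha.
    rewrite Rabs_minus_sym.
    eapply Rle_trans; [|apply (Hbd x a)].
    apply (increment_le G (fun t => C * atan t) g (fun t => C * / (1 + t ^ 2))); auto; [lra|].
    intros t Ht. apply Hb. nra.
Qed.

Lemma Ctotal_zero_antiderivative (g : R -> C) (K : R) :
  (forall y, Cmod (g y) <= K / (1 + y ^ 2) ^ 3) -> Ctotal g 0 ->
  exists G, (forall x, is_Cderive G x (g x)) /\
    forall x, Cmod (G x) <= (2 * (K * PI)) / (1 + x ^ 2) ^ 2.
Proof.
  intros HK [[G1 [A1 [B1 D1]]] [G2 [A2 [B2 D2]]]].
  exists (fun x => (G1 x, G2 x)). split.
  - intros x. split; [apply A1 | apply A2].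
  - intros x. eapply Rle_trans; [apply Cmod_le_Re_Im|]. simpl Re. simpl Im.
    assert (h1 := antiderivative_decay _ G1 K
      (fun y => Rle_trans _ _ _ (re_le_Cmod _) (HK y)) A1 B1 D1 x).
    assert (h2 := antiderivative_decay _ G2 K
      (fun y => Rle_trans _ _ _ (im_le_Cmod _) (HK y)) A2 B2 D2 x).
    replace (2 * (K * PI) / (1 + x ^ 2) ^ 2) with
      (K * PI / (1 + x ^ 2) ^ 2 + K * PI / (1 + x ^ 2) ^ 2) by (unfold Rdiv; ring).
    now apply Rplus_le_compat.
Qed.

Lemma filterlim_at_point (Y : R -> R) (x : R) : filterlim Y (at_point x) (locally (Y x)).
Proof. intros P HP. exact (locally_singleton _ _ HP). Qed.

(** The functions [a] and [b] vanish at both infinities, so the parts of the integral to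
    the left and to the right of [x] are equal: this is how the absence of the resonant
    frequency turns the two-sided kernel into a one-sided one. *)
Lemma RInt_gen_sin_abs (k x : R) (s a b : R -> R) :
  (forall y, continuous s y) ->
  (forall y, is_derive a y (cos (k * y) * s y)) ->
  (forall y, is_derive b y (sin (k * y) * s y)) ->
  is_lim a m_infty 0 -> is_lim a p_infty 0 -> is_lim b m_infty 0 -> is_lim b p_infty 0 ->
  is_RInt_gen (fun y => sin (k * Rabs (x - y)) * s y)
    (Rbar_locally m_infty) (Rbar_locally p_infty)
    (2 * (sin (k * x) * a x - cos (k * x) * b x)).
Proof.
  intros Hs Ha Hb am ap bm bp.
  set (Y := fun y => sin (k * x) * a y + - cos (k * x) * b y).
  assert (HY : forall y, is_derive Y y (sin (k * (x - y)) * s y)).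
  { intros y. eapply is_derive_eq.
    - apply (is_derive_plus (fun y => sin (k * x) * a y) (fun y => - cos (k * x) * b y));
        [apply (is_derive_scal a y (sin (k * x)) _ (Ha y))
        | apply (is_derive_scal b y (- cos (k * x)) _ (Hb y))].
    - replace (k * (x - y)) with (k * x - k * y) by ring. rewrite sin_minus.
      unfold plus; simpl. ring. }
  assert (HYd : forall y, Derive Y y = sin (k * (x - y)) * s y)
    by (intros; apply is_derive_unique, HY).
  assert (HYc : forall y, continuous (Derive Y) y).
  { intros y. apply continuous_ext with (fun y => sin (k * (x - y)) * s y);
      [intros; now rewrite HYd|].
    apply (continuous_mult (fun y => sin (k * (x - y))) s); [|apply Hs].
    apply (ex_derive_continuous (fun y => sin (k * (x - y))) y). auto_derive. trivial. }
  assert (Ym : is_lim Y m_infty 0).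
  { replace 0 with (sin (k * x) * 0 + - cos (k * x) * 0) by ring.
    apply is_lim_add; now apply is_lim_cmul. }
  assert (Yp : is_lim Y p_infty 0).
  { replace 0 with (sin (k * x) * 0 + - cos (k * x) * 0) by ring.
    apply is_lim_add; now apply is_lim_cmul. }
  replace (2 * (sin (k * x) * a x - cos (k * x) * b x)) with (plus (Y x - 0) (-1 * (0 - Y x)))
    by (unfold Y, plus; simpl; ring).
  apply (is_RInt_gen_Chasles (V := R_NormedModule) _ x); try apply Rbar_locally_filter.
  - apply (is_RInt_gen_ext (V := R_NormedModule) (Derive Y)); try apply Rbar_locally_filter;
      try apply at_point_filter.
    + exists (fun u => u < x) (fun v => v = x); [exists x; auto | reflexivity |].
      intros u v Hu Hv y. simpl. subst v. unfold Rmin, Rmax.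
      destruct (Rle_dec u x); [|lra]. intros Hy. rewrite HYd, Rabs_pos_eq; lra.
    + apply is_RInt_gen_Derive; try apply Rbar_locally_filter; try apply at_point_filter.
      * exists (fun _ => True) (fun _ => True); try apply filter_true; try exact I.
        intros; eexists; apply HY.
      * exists (fun _ => True) (fun _ => True); try apply filter_true; try exact I.
        intros; apply HYc.
      * exact Ym.
      * apply filterlim_at_point.
  - apply (is_RInt_gen_ext (V := R_NormedModule) (fun y => -1 * Derive Y y));
      try apply Rbar_locally_filter; try apply at_point_filter.
    + exists (fun v => v = x) (fun u => x < u); [reflexivity | exists x; auto |].
      intros u v Hu Hv y. simpl. subst u. unfold Rmin, Rmax.
      destruct (Rle_dec x v); [|lra]. intros Hy.
      rewrite HYd, Rabs_left by lra.
      replace (k * - (x - y)) with (- (k * (x - y))) by ring. rewrite sin_neg. ring.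
    + apply (is_RInt_gen_scal (V := R_NormedModule) (Derive Y) (-1));
        try apply Rbar_locally_filter; try apply at_point_filter.
      apply is_RInt_gen_Derive; try apply Rbar_locally_filter; try apply at_point_filter.
      * exists (fun _ => True) (fun _ => True); try apply filter_true; try exact I.
        intros; eexists; apply HY.
      * exists (fun _ => True) (fun _ => True); try apply filter_true; try exact I.
        intros; apply HYc.
      * apply filterlim_at_point.
      * exact Yp.
Qed.

(** * The operator T *)

Lemma schwartz_continuous (f : R -> C) : schwartz f ->
  (forall x, continuous (fun y => Re (f y)) x) /\
  (forall x, continuous (fun y => Im (f y)) x).
Proof.
  intros [H _].
  split; intros x; destruct (H 1%nat x) as [H1 H2];
    [apply (ex_derive_continuous (fun y => Re (f y)) x)
    | apply (ex_derive_continuous (fun y => Im (f y)) x)]; assumption.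
Qed.

(** A third power of [1 + x^2] leaves, after one integration, the second power that [tame]
    asks for. *)
Lemma schwartz_decay (f : R -> C) : schwartz f ->
  exists K, forall x, Cmod (f x) <= K / (1 + x ^ 2) ^ 3.
Proof.
  intros [_ H].
  destruct (H 0%nat 0%nat) as [M0 H0]. destruct (H 2%nat 0%nat) as [M2 H2].
  destruct (H 4%nat 0%nat) as [M4 H4]. destruct (H 6%nat 0%nat) as [M6 H6].
  exists (M0 + 3 * M2 + 3 * M4 + M6). intros x.
  assert (E : CDerive_n f 0 x = f x) by (unfold CDerive_n; simpl; now destruct (f x)).
  specialize (H0 x). specialize (H2 x). specialize (H4 x). specialize (H6 x).
  rewrite E in *. assert (p := one_plus_sq_pos x).
  apply Rmult_le_reg_r with ((1 + x ^ 2) ^ 3); [now apply pow_lt|].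
  replace ((M0 + 3 * M2 + 3 * M4 + M6) / (1 + x ^ 2) ^ 3 * (1 + x ^ 2) ^ 3) with
    (M0 + 3 * M2 + 3 * M4 + M6) by (field; lra).
  assert (Ex : (1 + x ^ 2) ^ 3 = Rabs x ^ 0 + 3 * Rabs x ^ 2 + 3 * Rabs x ^ 4 + Rabs x ^ 6).
  { rewrite <- (pow2_abs x). ring. }
  rewrite Ex. lra.
Qed.

Lemma decay_cubic_weaken (y K a : R) : 0 <= a <= K / (1 + y ^ 2) ^ 3 -> a <= K / (1 + y ^ 2).
Proof.
  intros [H0 H]. assert (p := one_plus_sq_pos y). assert (h := pow2_ge_0 y).
  apply decay_square_weaken. split; [assumption|].
  apply Rmult_le_compat_r with (r := 1 + y ^ 2) in H; [|lra].
  replace (K / (1 + y ^ 2) ^ 3 * (1 + y ^ 2)) with (K / (1 + y ^ 2) ^ 2) in H by (field; lra).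
  assert (0 <= a * y ^ 2) by (apply Rmult_le_pos; lra). lra.
Qed.

(** Variation of constants.  The vanishing of the transform at [+-2 lambda] says that the total
    integrals of [cos(2 lambda y) sigma] and [sin(2 lambda y) sigma] are zero, so that these have
    antiderivatives [A] and [B] that decay in both directions. *)
Lemma T_op_structure (lambda : R) (sigma : R -> C) : 0 < lambda -> schwartz sigma ->
  fourier sigma (2 * lambda) = RtoC 0 -> fourier sigma (- (2 * lambda)) = RtoC 0 ->
  exists (A B : R -> C) (K : R),
    (forall y, is_Cderive A y (RtoC (cos (2 * lambda * y)) * sigma y)%C) /\
    (forall y, is_Cderive B y (RtoC (sin (2 * lambda * y)) * sigma y)%C) /\
    (forall y, Cmod (A y) <= K / (1 + y ^ 2) ^ 2) /\
    (forall y, Cmod (B y) <= K / (1 + y ^ 2) ^ 2) /\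
    (forall x, T_op lambda sigma x =
      (RtoC (/ (2 * lambda)) * (RtoC (sin (2 * lambda * x)) * A x
        - RtoC (cos (2 * lambda * x)) * B x))%C).
Proof.
  intros Hl Hs Fp Fm.
  destruct (schwartz_continuous sigma Hs) as [c1 c2].
  destruct (schwartz_decay sigma Hs) as [K HK].
  assert (HK1 := fun y => decay_cubic_weaken y K _ (conj (Cmod_ge_0 _) (HK y))).
  assert (Tp := fourier_total_of_bound sigma K (2 * lambda) c1 c2 HK1).
  assert (Tm := fourier_total_of_bound sigma K (- (2 * lambda)) c1 c2 HK1).
  rewrite Fp in Tp. rewrite Fm in Tm.
  assert (TA : Ctotal (fun y => RtoC (cos (2 * lambda * y)) * sigma y)%C 0).
  { assert (h := Ctotal_plus _ _ _ _ (Ctotal_scal _ (/ 2)%C _ Tp) (Ctotal_scal _ (/ 2)%C _ Tm)).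
    replace (/ 2 * 0 + / 2 * 0)%C with (RtoC 0) in h by ring.
    revert h. apply Ctotal_ext. intros y. cbv beta.
    replace (/ 2 * (expi (- (y * (2 * lambda))) * sigma y) +
      / 2 * (expi (- (y * - (2 * lambda))) * sigma y))%C with
      (/ 2 * (expi (- (y * (2 * lambda))) + expi (- - (y * (2 * lambda)))) * sigma y)%C.
    - rewrite expi_cos, cos_neg, RtoC_mult.
      replace (y * (2 * lambda)) with (2 * lambda * y) by ring. field.
    - replace (- - (y * (2 * lambda))) with (- (y * - (2 * lambda))) by ring. ring. }
  assert (TB : Ctotal (fun y => RtoC (sin (2 * lambda * y)) * sigma y)%C 0).
  { assert (h := Ctotal_plus _ _ _ _ (Ctotal_scal _ (Ci / 2)%C _ Tp)
      (Ctotal_scal _ (- Ci / 2)%C _ Tm)).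
    replace (Ci / 2 * 0 + - Ci / 2 * 0)%C with (RtoC 0) in h by field.
    revert h. apply Ctotal_ext. intros y. cbv beta.
    replace (Ci / 2 * (expi (- (y * (2 * lambda))) * sigma y) +
      - Ci / 2 * (expi (- (y * - (2 * lambda))) * sigma y))%C with
      ((Ci / 2 * (expi (- (y * (2 * lambda))) - expi (- - (y * (2 * lambda))))) * sigma y)%C.
    - f_equal. replace (y * (2 * lambda)) with (2 * lambda * y) by ring.
      unfold expi, Ci, RtoC, Cdiv, Cinv, Cminus, Copp, Cplus, Cmult; simpl.
      rewrite !cos_neg, !sin_neg. f_equal; field.
    - replace (- - (y * (2 * lambda))) with (- (y * - (2 * lambda))) by ring. field. }
  assert (HcA : forall y, Cmod (RtoC (cos (2 * lambda * y)) * sigma y)%C <= K / (1 + y ^ 2) ^ 3).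
  { intros y. rewrite Cmod_mult, Cmod_R.
    assert (Rabs (cos (2 * lambda * y)) <= 1) by (apply Rabs_le; apply COS_bound).
    assert (p := Cmod_ge_0 (sigma y)). specialize (HK y).
    assert (q := Rabs_pos (cos (2 * lambda * y))). nra. }
  assert (HcB : forall y, Cmod (RtoC (sin (2 * lambda * y)) * sigma y)%C <= K / (1 + y ^ 2) ^ 3).
  { intros y. rewrite Cmod_mult, Cmod_R.
    assert (Rabs (sin (2 * lambda * y)) <= 1) by (apply Rabs_le; apply SIN_bound).
    assert (p := Cmod_ge_0 (sigma y)). specialize (HK y).
    assert (q := Rabs_pos (sin (2 * lambda * y))). nra. }
  destruct (Ctotal_zero_antiderivative _ K HcA TA) as [A [HA1 HA2]].
  destruct (Ctotal_zero_antiderivative _ K HcB TB) as [B [HB1 HB2]].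
  exists A, B, (2 * (K * PI)).
  split; [exact HA1|]. split; [exact HB1|]. split; [exact HA2|]. split; [exact HB2|].
  assert (Lim : forall (G : R -> C), (forall x, Cmod (G x) <= 2 * (K * PI) / (1 + x ^ 2) ^ 2) ->
    forall p, p = p_infty \/ p = m_infty ->
    is_lim (fun y => Re (G y)) p 0 /\ is_lim (fun y => Im (G y)) p 0).
  { intros G HG p Hp.
    assert (HG' : forall y, Cmod (G y) <= 2 * (K * PI) / (1 + y ^ 2)).
    { intros y. apply decay_square_weaken. split; [apply Cmod_ge_0 | apply HG]. }
    split; apply decay_lim with (2 * (K * PI)); auto; intros y.
    - eapply Rle_trans; [apply re_le_Cmod | apply HG'].
    - eapply Rle_trans; [apply im_le_Cmod | apply HG']. }
  destruct (Lim A HA2 p_infty (or_introl eq_refl)) as [Arp Aip].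
  destruct (Lim A HA2 m_infty (or_intror eq_refl)) as [Arm Aim].
  destruct (Lim B HB2 p_infty (or_introl eq_refl)) as [Brp Bip].
  destruct (Lim B HB2 m_infty (or_intror eq_refl)) as [Brm Bim].
  intros x. unfold T_op.
  replace (CInt (fun y => RtoC (sin (2 * lambda * Rabs (x - y))) * sigma y)%C) with
    (RtoC 2 * (RtoC (sin (2 * lambda * x)) * A x - RtoC (cos (2 * lambda * x)) * B x))%C.
  { replace (RtoC (/ (2 * lambda))) with (RtoC (1 / (4 * lambda)) * RtoC 2)%C; [ring|].
    rewrite <- RtoC_mult. f_equal. field. lra. }
  assert (dr : forall (G : R -> C) (g : R -> R), 
    (forall y, is_Cderive G y (RtoC (g y) * sigma y)%C) ->
    (forall y, is_derive (fun t => Re (G t)) y (g y * Re (sigma y))) /\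
    (forall y, is_derive (fun t => Im (G t)) y (g y * Im (sigma y)))).
  { intros G g HG. split; intros y; destruct (HG y) as [h1 h2].
    - rewrite re_scal_l in h1. exact h1.
    - eapply is_derive_eq; [exact h2|]. simpl. unfold Re, Im. ring. }
  destruct (dr A _ HA1) as [dA1 dA2]. destruct (dr B _ HB1) as [dB1 dB2].
  assert (P1 := RInt_gen_sin_abs (2 * lambda) x (fun y => Re (sigma y)) _ _
    c1 dA1 dB1 Arm Arp Brm Brp).
  assert (P2 := RInt_gen_sin_abs (2 * lambda) x (fun y => Im (sigma y)) _ _
    c2 dA2 dB2 Aim Aip Bim Bip).
  unfold CInt. symmetry.
  apply injective_projections; simpl fst; simpl snd.
  - transitivity (2 * (sin (2 * lambda * x) * Re (A x) - cos (2 * lambda * x) * Re (B x))).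
    + apply is_RInt_gen_unique; try apply Proper_StrongProper; try apply Rbar_locally_filter.
      revert P1. apply is_RInt_gen_ext; try apply Rbar_locally_filter.
      exists (fun _ => True) (fun _ => True); try apply filter_true.
      intros. simpl. unfold Re, Im. ring.
    + unfold Re. ring.
  - transitivity (2 * (sin (2 * lambda * x) * Im (A x) - cos (2 * lambda * x) * Im (B x))).
    + apply is_RInt_gen_unique; try apply Proper_StrongProper; try apply Rbar_locally_filter.
      revert P2. apply is_RInt_gen_ext; try apply Rbar_locally_filter.
      exists (fun _ => True) (fun _ => True); try apply filter_true.
      intros. simpl. unfold Re, Im. ring.
    + unfold Im. ring.
Qed.

Lemma Cmod_rot_le (a b : C) (t : R) :
  Cmod (RtoC (cos t) * a + RtoC (sin t) * b)%C <= Cmod a + Cmod b.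
Proof.
  eapply Rle_trans; [apply Cmod_triangle|]. rewrite 2!Cmod_mult, 2!Cmod_R.
  assert (Rabs (cos t) <= 1) by (apply Rabs_le; apply COS_bound).
  assert (Rabs (sin t) <= 1) by (apply Rabs_le; apply SIN_bound).
  assert (pa := Cmod_ge_0 a). assert (pb := Cmod_ge_0 b). nra.
Qed.

(** The last conclusion is the local estimate behind the half-period difference: shifting by
    [PI/(2 lambda)] reverses the signs of [sin(2 lambda x)] and [cos(2 lambda x)], so the sum is an
    increment of [A] and [B] over half a period, and sees [sigma] only there. *)
Lemma T_op_properties (lambda : R) (sigma : R -> C) : 0 < lambda -> schwartz sigma ->
  fourier sigma (2 * lambda) = RtoC 0 -> fourier sigma (- (2 * lambda)) = RtoC 0 ->
  exists delta1 : R -> C,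
    (forall x, is_Cderive (T_op lambda sigma) x (delta1 x)) /\
    (forall x, is_Cderive delta1 x
       (sigma x - RtoC (4 * lambda ^ 2) * T_op lambda sigma x)%C) /\
    tame (T_op lambda sigma) /\ tame delta1 /\
    (forall x kappa, (forall y, y <= x -> Cmod (sigma y) <= kappa) ->
       Cmod (T_op lambda sigma x + T_op lambda sigma (x - PI / (2 * lambda))%R)%C
         <= / (2 * lambda) * (kappa * (PI / (2 * lambda))) /\
       Cmod (delta1 x + delta1 (x - PI / (2 * lambda))%R)%C
         <= kappa * (PI / (2 * lambda))).
Proof.
  intros Hl Hs Fp Fm.
  destruct (T_op_structure lambda sigma Hl Hs Fp Fm) as [A [B [K [HA [HB [KA [KB ET]]]]]]].
  assert (Hinv : 0 < / (2 * lambda)) by (apply Rinv_0_lt_compat; lra).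
  set (d0 := T_op lambda sigma) in *.
  set (d1 := fun x => (RtoC (cos (2 * lambda * x)) * A x + RtoC (sin (2 * lambda * x)) * B x)%C).
  assert (Dc : forall x, is_Cderive (fun y => RtoC (cos (2 * lambda * y))) x
    (- (RtoC (2 * lambda) * RtoC (sin (2 * lambda * x))))%C).
  { intros x. replace (- (RtoC (2 * lambda) * RtoC (sin (2 * lambda * x))))%C with
      (RtoC (- (2 * lambda * sin (2 * lambda * x)))) by
      (now rewrite RtoC_opp, RtoC_mult).
    apply is_Cderive_RtoC. auto_derive; [trivial | ring]. }
  assert (Ds : forall x, is_Cderive (fun y => RtoC (sin (2 * lambda * y))) x
    (RtoC (2 * lambda) * RtoC (cos (2 * lambda * x)))%C).
  { intros x. rewrite <- RtoC_mult.
    apply is_Cderive_RtoC. auto_derive; [trivial | ring]. }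
  assert (Hsc : forall x, (RtoC (cos (2 * lambda * x)) * RtoC (cos (2 * lambda * x)) +
     RtoC (sin (2 * lambda * x)) * RtoC (sin (2 * lambda * x)))%C = RtoC 1).
  { intros x. rewrite <- !RtoC_mult, <- RtoC_plus. f_equal.
    assert (h := sin2_cos2 (2 * lambda * x)). unfold Rsqr in h. lra. }
  assert (E1 : (RtoC (/ (2 * lambda)) * RtoC (2 * lambda))%C = RtoC 1).
  { rewrite <- RtoC_mult. f_equal. field. lra. }
  assert (H01 : forall x, is_Cderive d0 x (d1 x)).
  { intros x.
    assert (D := is_Cderive_mult _ _ x _ _ (is_Cderive_const (RtoC (/ (2 * lambda))) x)
      (is_Cderive_plus _ _ x _ _ (is_Cderive_mult _ _ x _ _ (Ds x) (HA x))
        (is_Cderive_mult _ _ x _ _ (is_Cderive_const (- RtoC 1)%C x)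
          (is_Cderive_mult _ _ x _ _ (Dc x) (HB x))))).
    revert D. apply is_Cderive_ext.
    - intros y. rewrite ET. ring.
    - unfold d1. cbv beta.
      transitivity ((RtoC (/ (2 * lambda)) * RtoC (2 * lambda)) *
        (RtoC (cos (2 * lambda * x)) * A x + RtoC (sin (2 * lambda * x)) * B x))%C;
        [ring | rewrite E1; ring]. }
  assert (H12 : forall x, is_Cderive d1 x (sigma x - RtoC (4 * lambda ^ 2) * d0 x)%C).
  { intros x.
    assert (D := is_Cderive_plus _ _ x _ _ (is_Cderive_mult _ _ x _ _ (Dc x) (HA x))
          (is_Cderive_mult _ _ x _ _ (Ds x) (HB x))).
    revert D. apply is_Cderive_ext; [reflexivity|].
    rewrite ET.
    replace (RtoC (4 * lambda ^ 2)) with (RtoC (2 * lambda) * RtoC (2 * lambda))%C by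
      (rewrite <- RtoC_mult; f_equal; ring).
    transitivity ((RtoC (cos (2 * lambda * x)) * RtoC (cos (2 * lambda * x)) +
     RtoC (sin (2 * lambda * x)) * RtoC (sin (2 * lambda * x))) * sigma x -
     RtoC (2 * lambda) *
     (RtoC (sin (2 * lambda * x)) * A x - RtoC (cos (2 * lambda * x)) * B x))%C; [ring|].
    rewrite Hsc.
    transitivity (1 * sigma x - RtoC (2 * lambda) * (RtoC (/ (2 * lambda)) * RtoC (2 * lambda)) *
     (RtoC (sin (2 * lambda * x)) * A x - RtoC (cos (2 * lambda * x)) * B x))%C;
     [rewrite E1; ring | ring]. }
  assert (B1 : forall x, Cmod (d1 x) <= (K + K) / (1 + x ^ 2) ^ 2).
  { intros x. eapply Rle_trans; [apply Cmod_rot_le|].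
    unfold Rdiv. rewrite Rmult_plus_distr_r. apply Rplus_le_compat; [apply KA | apply KB]. }
  assert (B0 : forall x, Cmod (d0 x) <= (/ (2 * lambda) * (K + K)) / (1 + x ^ 2) ^ 2).
  { intros x. rewrite ET, Cmod_mult, Cmod_R, Rabs_pos_eq by lra.
    replace (/ (2 * lambda) * (K + K) / (1 + x ^ 2) ^ 2) with
      (/ (2 * lambda) * ((K + K) * / (1 + x ^ 2) ^ 2)) by (unfold Rdiv; ring).
    apply Rmult_le_compat_l; [lra|].
    replace (RtoC (sin (2 * lambda * x)) * A x - RtoC (cos (2 * lambda * x)) * B x)%C with
      (RtoC (cos (2 * lambda * x)) * - B x + RtoC (sin (2 * lambda * x)) * A x)%C by ring.
    eapply Rle_trans; [apply Cmod_rot_le|]. rewrite Cmod_opp.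
    rewrite Rmult_plus_distr_r. apply Rplus_le_compat; [apply KB | apply KA]. }
  assert (Hbd : forall (f : R -> C) M, (forall x, Cmod (f x) <= M / (1 + x ^ 2) ^ 2) ->
    forall x, Cmod (f x) <= M).
  { intros f M HM x. eapply Rle_trans; [apply HM|].
    assert (M0 : 0 <= M).
    { specialize (HM 0). replace (M / (1 + 0 ^ 2) ^ 2) with M in HM by field.
      eapply Rle_trans; [apply Cmod_ge_0 | exact HM]. }
    assert (h := pow2_ge_0 x).
    rewrite <- (Rmult_1_r M) at 2. apply Rmult_le_compat_l; [assumption|].
    rewrite <- Rinv_1. apply Rinv_le_contravar; [lra | nra]. }
  assert (BS : exists M, forall x, Cmod (sigma x) <= M).
  { destruct Hs as [_ Hs]. destruct (Hs 0%nat 0%nat) as [M HM]. exists M. intros x.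
    specialize (HM x). simpl in HM. rewrite Rmult_1_l in HM.
    unfold CDerive_n in HM. simpl in HM. now destruct (sigma x). }
  destruct BS as [M HM].
  exists d1. split; [exact H01|]. split; [exact H12|]. split; [|split].
  - exists (K + K), (/ (2 * lambda) * (K + K)). split; [|exact B0].
    apply Cmod_lipschitz with d1; [exact H01 | now apply Hbd].
  - exists (M + (4 * lambda ^ 2) * (/ (2 * lambda) * (K + K))), (K + K). split; [|exact B1].
    apply Cmod_lipschitz with (1 := H12). intros t.
    unfold Cminus. eapply Rle_trans; [apply Cmod_triangle|]. apply Rplus_le_compat; [apply HM|].
    assert (0 <= 4 * lambda ^ 2) by (assert (h := pow2_ge_0 lambda); lra).
    rewrite Cmod_opp, Cmod_mult, Cmod_R, Rabs_pos_eq by assumption.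
    apply Rmult_le_compat_l; [assumption|]. now apply Hbd.
  - intros x kappa Hk.
    assert (Hh : 0 < PI / (2 * lambda)) by (apply Rdiv_lt_0_compat; [apply PI_RGT_0 | lra]).
    set (h := PI / (2 * lambda)) in *.
    assert (Eh : 2 * lambda * (x - h) = 2 * lambda * x - PI) by (unfold h; field; lra).
    assert (Ec : cos (2 * lambda * (x - h)) = - cos (2 * lambda * x)).
    { rewrite Eh, cos_minus, cos_PI, sin_PI. ring. }
    assert (Es : sin (2 * lambda * (x - h)) = - sin (2 * lambda * x)).
    { rewrite Eh, sin_minus, cos_PI, sin_PI. ring. }
    assert (INC : forall (Y : R -> C) (g : R -> R), (forall y, Rabs (g y) <= 1) ->
      (forall y, is_Cderive Y y (RtoC (g y) * sigma y)%C) ->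
      Cmod (Y x - Y (x - h)%R)%C <= kappa * h).
    { intros Y g Hg HY. replace (kappa * h) with (kappa * (x - (x - h))) by ring.
      apply Cmod_increment with (fun y => (RtoC (g y) * sigma y)%C); [lra | intros; apply HY|].
      intros y Hy. rewrite Cmod_mult, Cmod_R. specialize (Hk y (proj2 Hy)). specialize (Hg y).
      assert (p1 := Cmod_ge_0 (sigma y)). assert (p2 := Rabs_pos (g y)). nra. }
    split.
    + rewrite 2!ET, Ec, Es, 2!RtoC_opp.
      set (Y := fun y => (RtoC (sin (2 * lambda * x)) * A y +
        - RtoC (cos (2 * lambda * x)) * B y)%C).
      replace (_ + _)%C with (RtoC (/ (2 * lambda)) * (Y x - Y (x - h)%R))%C by (unfold Y; ring).
      rewrite Cmod_mult, Cmod_R, Rabs_pos_eq by lra. apply Rmult_le_compat_l; [lra|].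
      apply INC with (fun y => sin (2 * lambda * x - 2 * lambda * y));
        [intros y; apply Rabs_le; apply SIN_bound|].
      intros y. rewrite sin_minus, RtoC_minus, !RtoC_mult.
      assert (D := is_Cderive_plus _ _ y _ _
        (is_Cderive_mult _ _ y _ _ (is_Cderive_const (RtoC (sin (2 * lambda * x))) y) (HA y))
        (is_Cderive_mult _ _ y _ _ (is_Cderive_const (- RtoC (cos (2 * lambda * x)))%C y) (HB y))).
      revert D. apply is_Cderive_ext; [reflexivity | cbv beta; ring].
    + unfold d1. rewrite Ec, Es, 2!RtoC_opp.
      set (Y := fun y => (RtoC (cos (2 * lambda * x)) * A y + RtoC (sin (2 * lambda * x)) * B y)%C).
      replace (_ + _)%C with (Y x - Y (x - h)%R)%C by (unfold Y; ring).
      apply INC with (fun y => cos (2 * lambda * x - 2 * lambda * y));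
        [intros y; apply Rabs_le; apply COS_bound|].
      intros y. rewrite cos_minus, RtoC_plus, !RtoC_mult.
      assert (D := is_Cderive_plus _ _ y _ _
        (is_Cderive_mult _ _ y _ _ (is_Cderive_const (RtoC (cos (2 * lambda * x))) y) (HA y))
        (is_Cderive_mult _ _ y _ _ (is_Cderive_const (RtoC (sin (2 * lambda * x)))%C y) (HB y))).
      revert D. apply is_Cderive_ext; [reflexivity | cbv beta; ring].
Qed.

(** Two integrations by parts in [delta'' + 4 lambda^2 delta = sigma]. *)
Lemma fourier_T_op (lambda : R) (sigma d0 d1 : R -> C) (xi : R) :
  schwartz sigma -> tame d0 -> tame d1 ->
  (forall x, is_Cderive d0 x (d1 x)) ->
  (forall x, is_Cderive d1 x (sigma x - RtoC (4 * lambda ^ 2) * d0 x)%C) ->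
  fourier d1 xi = (Ci * xi * fourier d0 xi)%C /\
  fourier sigma xi = (RtoC (4 * lambda ^ 2 - xi ^ 2) * fourier d0 xi)%C.
Proof.
  intros Hs T0 T1 H01 H12.
  assert (E : fourier d1 xi = (Ci * xi * fourier d0 xi)%C).
  { eapply Ctotal_unique; [now apply fourier_total | now apply fourier_derivative]. }
  split; [exact E|].
  destruct (schwartz_continuous sigma Hs) as [c1 c2].
  destruct (schwartz_decay sigma Hs) as [K HK].
  assert (HK1 := fun y => decay_cubic_weaken y K _ (conj (Cmod_ge_0 _) (HK y))).
  eapply Ctotal_unique; [exact (fourier_total_of_bound sigma K xi c1 c2 HK1)|].
  assert (h := Ctotal_plus _ _ _ _ (fourier_derivative d1 _ xi T1 H12)
    (Ctotal_scal _ (RtoC (4 * lambda ^ 2)) _ (fourier_total d0 xi T0))).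
  rewrite E in h.
  replace (RtoC (4 * lambda ^ 2 - xi ^ 2) * fourier d0 xi)%C with
    (Ci * xi * (Ci * xi * fourier d0 xi) + RtoC (4 * lambda ^ 2) * fourier d0 xi)%C.
  - revert h. apply Ctotal_ext. intros y. cbv beta. ring.
  - rewrite RtoC_minus, RtoC_pow.
    replace (Ci * xi * (Ci * xi * fourier d0 xi))%C with ((Ci * Ci) * (xi * xi * fourier d0 xi))%C
      by ring.
    replace (Ci * Ci)%C with (- RtoC 1)%C; [ring|].
    unfold Ci, RtoC, Cmult, Copp; simpl. f_equal; ring.
Qed.

(** * Numerical constants and the filter estimate *)

(** Machin's formula [PI/4 = 4 atan(1/5) - atan(1/239)] and [atan t <= t]. *)
Lemma PI_le_16_5 : PI <= 16 / 5.
Proof.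
  assert (h1 : Rabs (atan (/ 5) - atan 0) <= / 5 - 0).
  { apply (increment_le atan (fun y => y) (fun y => / (1 + Rsqr y)) (fun _ => 1)); [lra | | |].
    - intros y _. apply is_derive_atan.
    - intros y _. apply (is_derive_id y).
    - intros y _. assert (h := Rle_0_sqr y).
      rewrite Rabs_pos_eq by (apply Rlt_le, Rinv_0_lt_compat; lra).
      rewrite <- Rinv_1 at 2. apply Rinv_le_contravar; lra. }
  assert (h2 : atan 0 < atan (/ 239)) by (apply atan_increasing; lra).
  rewrite atan_0 in *. apply Rabs_le_between in h1.
  assert (h3 := Machin_4_5_239). lra.
Qed.

Lemma PI_ge_3 : 3 <= PI.
Proof. assert (h := PI2_3_2). lra. Qed.

Lemma sqrt2_bounds : 0 <= sqrt 2 <= 3 / 2 /\ sqrt 2 * sqrt 2 = 2.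
Proof.
  assert (h := sqrt_sqrt 2 ltac:(lra)). assert (p := sqrt_pos 2).
  split; [split; [assumption|]|assumption]. nra.
Qed.

Lemma exp_pow (x : R) (n : nat) : exp x ^ n = exp (INR n * x).
Proof.
  induction n as [|n IH]; [now rewrite Rmult_0_l, exp_0|].
  rewrite S_INR. simpl. rewrite IH, <- exp_plus. f_equal. ring.
Qed.

Lemma Rabs_sin_le (t : R) : Rabs (sin t) <= Rabs t.
Proof.
  assert (H : forall s, 0 <= s -> Rabs (sin s) <= s).
  { intros s Hs. assert (h : Rabs (sin s - sin 0) <= s - 0).
    { apply (increment_le sin (fun y => y) cos (fun _ => 1)); [lra | | |].
      - intros y _. apply is_derive_sin.
      - intros y _. apply (is_derive_id y).
      - intros y _. apply Rabs_le. apply COS_bound. }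
    rewrite sin_0, 2!Rminus_0_r in h. exact h. }
  destruct (Rle_dec 0 t) as [h|h].
  - rewrite (Rabs_pos_eq t) by assumption. now apply H.
  - rewrite <- (Rabs_Ropp (sin t)), <- sin_neg, (Rabs_left t) by lra. apply H. lra.
Qed.

(** With [s = 2|xi|/lambda], [|sin| <= s <= exp(s-1)] for [s <= 1], so the power is at most
    [exp(-(mu lambda/2)(1-s))], while [exp(-mu|xi|) = exp(-(mu lambda/2) s)].  For [s >= 1] the
    exponential alone suffices. *)
Lemma half_diff_filter_le (lambda mu xi : R) (n : nat) : 0 < lambda -> 0 < mu ->
  mu * lambda / 2 <= INR n ->
  Rabs (sin (PI / (2 * lambda) * xi / 2)) ^ n * exp (- mu * Rabs xi)
    <= exp (- (mu * lambda / 2)).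
Proof.
  intros Hl Hm Hn. set (s := 2 * Rabs xi / lambda).
  assert (Es : Rabs xi = s * lambda / 2) by (unfold s; field; lra).
  assert (Hs : 0 <= s).
  { unfold s. apply Rmult_le_pos; [|apply Rlt_le, Rinv_0_lt_compat; lra].
    assert (h := Rabs_pos xi). lra. }
  set (r := Rabs (sin (PI / (2 * lambda) * xi / 2))).
  assert (Hr0 : 0 <= r) by apply Rabs_pos.
  assert (Hr1 : r <= 1) by (apply Rabs_le; apply SIN_bound).
  assert (Hrs : r <= s).
  { unfold r. eapply Rle_trans; [apply Rabs_sin_le|].
    replace (PI / (2 * lambda) * xi / 2) with (PI / (4 * lambda) * xi) by (field; lra).
    assert (hp := PI_4). assert (hq := PI_RGT_0).
    rewrite Rabs_mult, Rabs_pos_eq by (apply Rlt_le, Rdiv_lt_0_compat; lra).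
    rewrite Es. replace (PI / (4 * lambda) * (s * lambda / 2)) with (PI / 8 * s) by (field; lra).
    nra. }
  assert (Hpow : r ^ n <= exp (Rmin 0 (mu * lambda / 2 * (s - 1)))).
  { unfold Rmin. destruct (Rle_dec 0 (mu * lambda / 2 * (s - 1))) as [h|h].
    - rewrite exp_0, <- (pow1 n). apply pow_incr. lra.
    - apply Rle_trans with (exp (s - 1) ^ n).
      + apply pow_incr. split; [assumption|]. assert (q := exp_ineq1_le (s - 1)). lra.
      + rewrite exp_pow. apply exp_le.
        assert (Hs1 : s - 1 <= 0).
        { destruct (Rle_dec s 1) as [|k]; [lra|]. exfalso. apply h. apply Rmult_le_pos; nra. }
        apply Ropp_le_cancel. rewrite <- 2!Ropp_mult_distr_r_reverse.
        apply Rmult_le_compat_r; lra. }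
  eapply Rle_trans; [apply Rmult_le_compat_r; [apply Rlt_le, exp_pos | exact Hpow]|].
  rewrite <- exp_plus. apply exp_le. rewrite Es.
  unfold Rmin. destruct (Rle_dec 0 (mu * lambda / 2 * (s - 1))) as [h|h]; lra.
Qed.

(** Both parts integrate a pointwise bound over [[0, sqrt 2 lambda]].  In the second one the
    filter has made the bound constant, so the length of the interval appears instead of
    [1/mu]. *)
Lemma band_limited_sup_bounds (f : R -> C) (lambda mu c : R) (n : nat) :
  0 < lambda -> 0 < mu -> mu * lambda / 2 <= INR n -> tame f ->
  (forall xi, Rabs xi <= sqrt 2 * lambda -> Cmod (fourier f xi) <= c * exp (- mu * Rabs xi)) ->
  (forall xi, Rabs xi > sqrt 2 * lambda -> Rabs xi <> 2 * lambda -> fourier f xi = RtoC 0) ->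
  (forall x, Cmod (f x) * PI <= c / mu) /\
  (forall x, Cmod (Nat.iter n (half_diff (PI / (2 * lambda))) f x) * PI <=
     c * (sqrt 2 * lambda) * exp (- (mu * lambda / 2))).
Proof.
  intros Hl Hm Hn Hf Hb H0. destruct sqrt2_bounds as [[s1 s2] _].
  assert (HB : 0 <= sqrt 2 * lambda < 2 * lambda) by nra.
  assert (c0 : 0 <= c).
  { assert (h := Hb 0). rewrite Rabs_R0, Rmult_0_r, exp_0, Rmult_1_r in h.
    eapply Rle_trans; [apply Cmod_ge_0 | apply h; lra]. }
  split; intros x.
  - eapply Rle_trans.
    + apply (fourier_sup_bound f (fun t => c * exp (- mu * t))
        (fun t => - (c / mu) * exp (- mu * t)) _ _ Hf HB); try assumption.
      intros t _. auto_derive; [trivial|]. field. lra.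
    + cbv beta. rewrite Rmult_0_r, exp_0.
      assert (0 <= c / mu * exp (- mu * (sqrt 2 * lambda))); [|lra].
      apply Rmult_le_pos; [|apply Rlt_le, exp_pos].
      apply Rmult_le_pos; [assumption | apply Rlt_le, Rinv_0_lt_compat; lra].
  - set (g := Nat.iter n (half_diff (PI / (2 * lambda))) f).
    assert (Hg : tame g) by apply (Cmod_fourier_iter_half_diff _ f n 0 Hf).
    assert (Fg : forall xi, Cmod (fourier g xi) =
      Rabs (sin (PI / (2 * lambda) * xi / 2)) ^ n * Cmod (fourier f xi)).
    { intros xi. apply (Cmod_fourier_iter_half_diff _ f n xi Hf). }
    eapply Rle_trans.
    + apply (fourier_sup_bound g (fun t => c * exp (- (mu * lambda / 2)))
        (fun t => c * exp (- (mu * lambda / 2)) * t) _ _ Hg HB).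
      * intros t _. auto_derive; [trivial|]. ring.
      * intros xi Hxi. rewrite Fg.
        assert (h := half_diff_filter_le lambda mu xi n Hl Hm Hn).
        eapply Rle_trans; [apply Rmult_le_compat_l; [apply pow_le, Rabs_pos | apply Hb, Hxi]|].
        apply Rmult_le_compat_l with (r := c) in h; [|assumption]. lra.
      * intros xi h1 h2. apply Cmod_eq_0. rewrite Fg, (H0 xi h1 h2), Cmod_0. ring.
    + cbv beta. lra.
Qed.

(** On the band [4 lambda^2 - xi^2 >= 2 lambda^2]; off the band the only zero of this factor
    is the exceptional frequency. *)
Lemma fourier_T_op_bounds (lambda mu a : R) (sigma d0 d1 : R -> C) : 0 < lambda ->
  schwartz sigma -> tame d0 -> tame d1 ->
  (forall x, is_Cderive d0 x (d1 x)) ->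
  (forall x, is_Cderive d1 x (sigma x - RtoC (4 * lambda ^ 2) * d0 x)%C) ->
  (forall xi, Rabs xi <= sqrt 2 * lambda ->
     Cmod (fourier sigma xi) <= a * exp (- mu * Rabs xi)) ->
  (forall xi, Rabs xi > sqrt 2 * lambda -> fourier sigma xi = RtoC 0) ->
  (forall xi, Rabs xi <= sqrt 2 * lambda ->
     Cmod (fourier d0 xi) <= a / (2 * lambda ^ 2) * exp (- mu * Rabs xi)) /\
  (forall xi, Rabs xi > sqrt 2 * lambda -> Rabs xi <> 2 * lambda ->
     fourier d0 xi = RtoC 0) /\
  (forall xi, Rabs xi <= sqrt 2 * lambda ->
     Cmod (fourier d1 xi) <=
       sqrt 2 * lambda * (a / (2 * lambda ^ 2)) * exp (- mu * Rabs xi)) /\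
  (forall xi, Rabs xi > sqrt 2 * lambda -> Rabs xi <> 2 * lambda ->
     fourier d1 xi = RtoC 0).
Proof.
  intros Hl Hs T0 T1 H01 H12 Hfs Hf0.
  destruct sqrt2_bounds as [[s1 s2] s3].
  assert (HF := fun xi => fourier_T_op lambda sigma d0 d1 xi Hs T0 T1 H01 H12).
  assert (p2 : 0 < lambda ^ 2) by nra.
  assert (Ha2 : forall xi, Rabs xi <= sqrt 2 * lambda -> xi ^ 2 <= 2 * lambda ^ 2).
  { intros xi Hxi. rewrite <- (pow2_abs xi). assert (q := Rabs_pos xi).
    assert (Eb : (sqrt 2 * lambda) ^ 2 = 2 * lambda ^ 2).
    { transitivity ((sqrt 2 * sqrt 2) * lambda ^ 2); [ring | rewrite s3; ring]. }
    rewrite <- Eb. apply pow_incr. lra. }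
  assert (B0 : forall xi, Rabs xi <= sqrt 2 * lambda ->
    Cmod (fourier d0 xi) <= a / (2 * lambda ^ 2) * exp (- mu * Rabs xi)).
  { intros xi Hxi. assert (h := Hfs xi Hxi). destruct (HF xi) as [_ E].
    specialize (Ha2 xi Hxi).
    rewrite E, Cmod_mult, Cmod_R, Rabs_pos_eq in h by lra.
    assert (q := Cmod_ge_0 (fourier d0 xi)).
    apply Rmult_le_reg_l with (2 * lambda ^ 2); [lra|].
    replace (2 * lambda ^ 2 * (a / (2 * lambda ^ 2) * exp (- mu * Rabs xi))) with
      (a * exp (- mu * Rabs xi)) by (field; lra).
    eapply Rle_trans; [|exact h]. apply Rmult_le_compat_r; lra. }
  assert (Z0 : forall xi, Rabs xi > sqrt 2 * lambda -> Rabs xi <> 2 * lambda ->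
    fourier d0 xi = RtoC 0).
  { intros xi h1 h2. destruct (HF xi) as [_ E]. rewrite (Hf0 xi h1) in E.
    assert (n : RtoC (4 * lambda ^ 2 - xi ^ 2) <> RtoC 0).
    { intros h. apply RtoC_inj in h. apply h2.
      rewrite <- (pow2_abs xi) in h. assert (q := Rabs_pos xi). nra. }
    replace (fourier d0 xi) with
      (RtoC (4 * lambda ^ 2 - xi ^ 2) * fourier d0 xi / RtoC (4 * lambda ^ 2 - xi ^ 2))%C
      by (field; exact n).
    rewrite <- E. field. exact n. }
  split; [exact B0|]. split; [exact Z0|]. split.
  - intros xi Hxi. destruct (HF xi) as [E _].
    rewrite E, 2!Cmod_mult, Cmod_Ci, Cmod_R, Rmult_1_l, Rmult_assoc.
    apply Rmult_le_compat; [apply Rabs_pos | apply Cmod_ge_0 | exact Hxi | now apply B0].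
  - intros xi h1 h2. destruct (HF xi) as [E _]. rewrite E, (Z0 xi h1 h2). ring.
Qed.

(** * The nonlinear term *)

(** Makes the tail of the exponential series comparable to a geometric series. *)
Lemma INR_fact_ge (k : nat) : 2 ^ (k + 1) <= INR (fact (k + 2)).
Proof.
  induction k as [|k IH]; [simpl; lra|].
  replace (S k + 2)%nat with (S (k + 2)) by lia.
  rewrite fact_simpl, mult_INR. simpl (2 ^ (S k + 1)).
  apply Rmult_le_compat; [lra | apply pow_le; lra | | exact IH].
  replace 2 with (INR 2) by reflexivity. apply le_INR. lia.
Qed.

(** Real and imaginary parts are each at most [d^2/(2-d)] by comparison with a geometric
    series of ratio [d/2], and [1/(2-d) <= 5/8] for [d <= 2/5]. *)
Lemma exp_tail_bound (z : C) : Cmod z <= 2 / 5 ->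
  Cmod (CSeries (fun k => z ^ (k + 2) / RtoC (INR (fact (k + 2))))%C) <= 5 / 4 * Cmod z ^ 2.
Proof.
  intros Hz. assert (p := Cmod_ge_0 z). set (d := Cmod z) in *.
  assert (Hterm : forall k, Cmod (z ^ (k + 2) / RtoC (INR (fact (k + 2))))%C
    <= d ^ 2 / 2 * (d / 2) ^ k).
  { intros k. assert (hf := INR_fact_ge k).
    assert (h2 : 0 < 2 ^ (k + 1)) by (apply pow_lt; lra).
    rewrite Cmod_div, Cmod_pow, Cmod_R, Rabs_pos_eq;
      [|lra | intros E; apply RtoC_inj in E; lra].
    replace (d ^ 2 / 2 * (d / 2) ^ k) with (d ^ (k + 2) * / 2 ^ (k + 1)).
    - apply Rmult_le_compat_l; [now apply pow_le|]. apply Rinv_le_contravar; lra.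
    - unfold Rdiv. rewrite Rpow_mult_distr, !pow_add, pow_inv. simpl. field.
      apply pow_nonzero. lra. }
  assert (Hser : is_series (fun k => d ^ 2 / 2 * (d / 2) ^ k) (d ^ 2 / 2 * / (1 - d / 2))).
  { apply (is_series_scal (d ^ 2 / 2) (fun k => (d / 2) ^ k)). apply is_series_geom.
    rewrite Rabs_pos_eq; lra. }
  assert (Hcomp : forall a : nat -> R, (forall k, Rabs (a k) <= d ^ 2 / 2 * (d / 2) ^ k) ->
    Rabs (Series a) <= 5 / 8 * d ^ 2).
  { intros a Ha. eapply Rle_trans; [apply Series_Rabs|].
    - apply (ex_series_le (K := R_AbsRing) (V := R_CompleteNormedModule)
        (fun k => Rabs (a k)) (fun k => d ^ 2 / 2 * (d / 2) ^ k)).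
      + intros k. change (Rabs (Rabs (a k)) <= d ^ 2 / 2 * (d / 2) ^ k).
        rewrite Rabs_Rabsolu. apply Ha.
      + eexists; exact Hser.
    - eapply Rle_trans; [apply Series_le|].
      + intros k. split; [apply Rabs_pos | apply Ha].
      + eexists; exact Hser.
      + rewrite (is_series_unique _ _ Hser).
        replace (5 / 8 * d ^ 2) with (d ^ 2 / 2 * (5 / 4)) by field.
        apply Rmult_le_compat_l; [assert (h := pow2_ge_0 d); lra|].
        replace (5 / 4) with (/ (4 / 5)) by field. apply Rinv_le_contravar; lra. }
  eapply Rle_trans; [apply Cmod_le_Re_Im|].
  assert (h1 := Hcomp _ (fun k => Rle_trans _ _ _ (re_le_Cmod _) (Hterm k))).
  assert (h2 := Hcomp _ (fun k => Rle_trans _ _ _ (im_le_Cmod _) (Hterm k))).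
  apply Rle_trans with (5 / 8 * d ^ 2 + 5 / 8 * d ^ 2);
    [apply Rplus_le_compat; [exact h1 | exact h2] | lra].
Qed.

Lemma S_op_bound (lambda : R) (f : R -> C) (x : R) : Cmod (f x) <= 2 / 5 ->
  Cmod (S_op lambda f x) <= Cmod (CDerive f x) ^ 2 / 4 + 5 * (lambda * Cmod (f x)) ^ 2.
Proof.
  intros H. unfold S_op, Cminus. eapply Rle_trans; [apply Cmod_triangle|].
  apply Rplus_le_compat.
  - rewrite Cmod_div, Cmod_pow, Cmod_R, Rabs_pos_eq; [lra | lra |].
    intros E; apply RtoC_inj in E; lra.
  - assert (h := pow2_ge_0 lambda).
    rewrite Cmod_opp, Cmod_mult, Cmod_R, Rabs_pos_eq by lra.
    assert (hs := exp_tail_bound (f x) H).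
    apply Rmult_le_compat_l with (r := 4 * lambda ^ 2) in hs; [|lra].
    eapply Rle_trans; [exact hs|]. right. field.
Qed.

(** * The closing inequality on the half-line *)

Lemma exp_2_ge : 59 / 10 <= exp 2.
Proof.
  replace 2 with (INR 8 * (1 / 4)) by (simpl; lra). rewrite <- exp_pow.
  assert (h := exp_ineq1_le (1 / 4)).
  apply Rle_trans with ((1 + 1 / 4) ^ 8); [lra|]. apply pow_incr. lra.
Qed.

(** Here [N (PI/(2 lambda))/2 <= (3/5) X/lambda].  The quadratic term is absorbed by one factor
    [Q <= 3 Gamma/(8X)], and contributes at most [0.3 Q].  In the term [M^2] one factor is
    controlled by [X M/lambda <= 3 X exp(-X/2) <= 12 exp(-2)].  The resulting coefficients of
    [M] sum to less than [0.7]. *)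
Lemma quadratic_closure (lambda Gamma X C1 E Q N : R) :
  0 < lambda -> 0 < Gamma -> 4 * Gamma <= lambda -> 4 <= X ->
  E = exp (- (X / 2)) -> 24 * Gamma <= C1 <= 6 * lambda ->
  0 <= N <= X / 2 + 1 -> 0 <= Q -> Q * (8 * X) <= 3 * Gamma ->
  Q <= Gamma * E / 2 +
       N * ((21 / 4 * Q ^ 2 + (C1 / 2 * E) ^ 2 / 2) * (PI / (2 * lambda)) / 2) ->
  Q <= C1 / 2 * E.
Proof.
  intros Hl HG HGl HX HE HC HN HQ0 HQ H.
  assert (E0 : 0 < E) by (rewrite HE; apply exp_pos).
  set (M := C1 / 2 * E) in *.
  assert (HM0 : 0 < M) by (unfold M; nra).
  assert (Ha : Gamma * E / 2 <= M / 24) by (unfold M; nra).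
  assert (Hi : 0 < / lambda) by now apply Rinv_0_lt_compat.
  (* exp(X/2) = exp 2 * exp(X/2 - 2) >= 5.9 (X/2 - 1) >= 5.9 X/4, with equality of the
     last two terms at X = 4. *)
  assert (HXE : X * E * (59 / 10) <= 4).
  { assert (h1 := exp_ineq1_le (X / 2 - 2)). assert (h2 := exp_2_ge).
    assert (h3 : E * (exp 2 * exp (X / 2 - 2)) = 1).
    { rewrite HE, <- !exp_plus, <- exp_0. f_equal. field. }
    assert (h4 : 59 / 10 * (X / 4) <= exp 2 * exp (X / 2 - 2)).
    { apply Rmult_le_compat; lra. }
    apply Rmult_le_compat_l with (r := E) in h4; [|lra]. rewrite h3 in h4. lra. }
  assert (HXM : X * M * / lambda * (59 / 10) <= 12).
  { unfold M. assert (C1 * / lambda <= 6).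
    { apply Rmult_le_reg_r with lambda; [assumption|].
      rewrite Rmult_assoc, Rinv_l by lra. lra. }
    assert (0 <= X * E) by nra.
    replace (X * (C1 / 2 * E) * / lambda * (59 / 10)) with
      (C1 * / lambda * (X * E) * (59 / 10) / 2) by (unfold Rdiv; ring).
    nra. }
  assert (HXQ : X * Q * / lambda <= 3 / 32).
  { apply Rmult_le_reg_r with lambda; [assumption|].
    rewrite Rmult_assoc, Rinv_l by lra. lra. }
  set (k := 21 / 4 * Q ^ 2 + M ^ 2 / 2) in *.
  assert (k0 : 0 <= k) by (unfold k; assert (h := pow2_ge_0 Q); assert (h' := pow2_ge_0 M); lra).
  assert (Hstep : N * (k * (PI / (2 * lambda)) / 2) <= 3 / 5 * (X * / lambda) * k).
  { assert (hp := PI_le_16_5). assert (hq := PI_RGT_0).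
    replace (N * (k * (PI / (2 * lambda)) / 2)) with (N * PI * (k * / lambda) / 4)
      by (field; lra).
    replace (3 / 5 * (X * / lambda) * k) with (12 / 5 * X * (k * / lambda) / 4) by (field; lra).
    assert (0 <= k * / lambda) by nra.
    assert (N * PI <= 3 / 4 * X * (16 / 5)) by (apply Rmult_le_compat; lra).
    nra. }
  assert (Ek : 3 / 5 * (X * / lambda) * k =
    63 / 20 * (X * Q * / lambda) * Q + 3 / 10 * (X * M * / lambda) * M) by (unfold k; field; lra).
  assert (63 / 20 * (X * Q * / lambda) * Q <= 63 / 20 * (3 / 32) * Q) by nra.
  assert (3 / 10 * (X * M * / lambda) * M <= 3 / 10 * (120 / 59) * M) by nra.
  lra.
Qed.

(** The supremum [Q] is finite by the bounds on the whole line, so the inequality that it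
    satisfies on the half-line can be closed directly, without a continuity argument
    starting at [-oo]. *)
Lemma oscillator_small_on_left (lambda Gamma mu C1 x0 : R) (p sigma nu : R -> C) :
  0 < lambda -> 0 < Gamma -> 0 < mu -> 4 * Gamma <= lambda -> 4 <= mu * lambda ->
  24 * Gamma <= C1 <= 6 * lambda -> schwartz sigma ->
  (forall x, sigma x = (S_op lambda (T_op lambda sigma) x + p x + nu x)%C) ->
  (forall xi, Rabs xi <= sqrt 2 * lambda ->
     Cmod (fourier sigma xi) <= 3 * Gamma / 2 * exp (- mu * Rabs xi)) ->
  (forall xi, Rabs xi > sqrt 2 * lambda -> fourier sigma xi = RtoC 0) ->
  (forall x, x <= x0 -> Cmod (p x) + Cmod (nu x) <= (C1 / 2 * exp (- (mu * lambda / 2))) ^ 2 / 2) ->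
  forall x, x <= x0 ->
    lambda * Cmod (T_op lambda sigma x) <= C1 / 2 * exp (- (mu * lambda / 2)) /\
    Cmod (CDerive (T_op lambda sigma) x) <= C1 / 2 * exp (- (mu * lambda / 2)).
Proof.
  intros Hl HG Hm HGl HX HC Hs Heq Hfs Hf0 Hpn.
  destruct sqrt2_bounds as [[s1 s2] s3].
  assert (F2 : forall e, Rabs e = 2 * lambda -> fourier sigma e = RtoC 0).
  { intros e He. apply Hf0. rewrite He. nra. }
  destruct (T_op_properties lambda sigma Hl Hs) as [d1 [H01 [H12 [T0 [T1 Hhalf]]]]].
  { apply F2. apply Rabs_pos_eq. lra. }
  { apply F2. rewrite Rabs_Ropp. apply Rabs_pos_eq. lra. }
  set (d0 := T_op lambda sigma) in *.
  assert (HD : forall x, CDerive d0 x = d1 x).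
  { intros x. destruct (H01 x) as [h1 h2].
    apply injective_projections; apply is_derive_unique; [exact h1 | exact h2]. }
  assert (p2 : 0 < lambda ^ 2) by nra.
  set (c := 3 * Gamma / 2 / (2 * lambda ^ 2)).
  destruct (fourier_T_op_bounds lambda mu (3 * Gamma / 2) sigma d0 d1)
    as [B0 [Z0 [B1 Z1]]]; try assumption. fold c in B0, B1.
  set (X := mu * lambda) in *. set (E := exp (- (X / 2))) in *.
  assert (E0 : 0 < E) by apply exp_pos.
  (* The number of differences: the least value that makes the filter effective is X/2,
     and each further one costs in the local estimate. *)
  destruct (nfloor_ex (X / 2)) as [m [Hm1 Hm2]]; [lra|].
  set (n := S m).
  assert (Hn : X / 2 <= INR n <= X / 2 + 1) by (unfold n; rewrite S_INR; lra).
  destruct (band_limited_sup_bounds d0 lambda mu c n Hl Hm (proj1 Hn) T0 B0 Z0) as [G0 R0].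
  destruct (band_limited_sup_bounds d1 lambda mu _ n Hl Hm (proj1 Hn) T1 B1 Z1) as [G1 R1].
  fold X in R0, R1. fold E in R0, R1.
  assert (hp := PI_ge_3).
  assert (Hi : 0 < / lambda) by now apply Rinv_0_lt_compat.
  (* PI is replaced by 3 and sqrt 2 by 3/2 in the bounds that follow. *)
  assert (G0' : forall x, lambda * Cmod (d0 x) * (8 * X) <= 3 * Gamma).
  { intros x. specialize (G0 x). assert (q := Cmod_ge_0 (d0 x)).
    assert (h : Cmod (d0 x) * 3 <= c / mu) by nra.
    replace (c / mu) with (3 * Gamma / 4 * / (lambda * X)) in h by (unfold c, X; field; lra).
    apply Rmult_le_compat_r with (r := lambda * X) in h; [|nra].
    rewrite Rmult_assoc, Rmult_assoc, Rinv_l in h by nra. nra. }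
  assert (G1' : forall x, Cmod (d1 x) * (8 * X) <= 3 * Gamma).
  { intros x. specialize (G1 x). assert (q := Cmod_ge_0 (d1 x)).
    assert (h : Cmod (d1 x) * 3 <= sqrt 2 * lambda * c / mu) by nra.
    replace (sqrt 2 * lambda * c / mu) with (sqrt 2 * (3 * Gamma / 4) * / X) in h
      by (unfold c, X; field; lra).
    apply Rmult_le_compat_r with (r := X) in h; [|lra].
    rewrite Rmult_assoc, Rmult_assoc, Rinv_l in h by lra.
    assert (sqrt 2 * (3 * Gamma / 4) <= 3 / 2 * (3 * Gamma / 4)) by nra. nra. }
  assert (R0' : forall x, lambda * Cmod (Nat.iter n (half_diff (PI / (2 * lambda))) d0 x)
    <= Gamma * E / 2).
  { intros x. specialize (R0 x).
    set (r := Cmod (Nat.iter n (half_diff (PI / (2 * lambda))) d0 x)) in *.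
    assert (q : 0 <= r) by apply Cmod_ge_0.
    assert (h : r * 3 <= c * (sqrt 2 * lambda) * E) by nra.
    replace (c * (sqrt 2 * lambda) * E) with (sqrt 2 * (3 * Gamma / 4) * E * / lambda) in h
      by (unfold c; field; lra).
    apply Rmult_le_compat_r with (r := lambda) in h; [|lra].
    rewrite (Rmult_assoc _ (/ lambda)), Rinv_l in h by lra.
    assert (0 < Gamma * E) by nra.
    assert (sqrt 2 * (3 * Gamma / 4) * E <= 3 / 2 * (Gamma * E)) by nra. nra. }
  assert (R1' : forall x, Cmod (Nat.iter n (half_diff (PI / (2 * lambda))) d1 x)
    <= Gamma * E / 2).
  { intros x. specialize (R1 x).
    set (r := Cmod (Nat.iter n (half_diff (PI / (2 * lambda))) d1 x)) in *.
    assert (q : 0 <= r) by apply Cmod_ge_0.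
    assert (h : r * 3 <= sqrt 2 * lambda * c * (sqrt 2 * lambda) * E) by nra.
    replace (sqrt 2 * lambda * c * (sqrt 2 * lambda) * E) with
      ((sqrt 2 * sqrt 2) * (3 * Gamma / 4) * E) in h by (unfold c; field; lra).
    rewrite s3 in h. lra. }
  (* One supremum for both quantities: the bound on sigma involves delta and delta'
     together. *)
  set (S := fun r => exists x, x <= x0 /\ (r = lambda * Cmod (d0 x) \/ r = Cmod (d1 x))).
  destruct (completeness S) as [Q [Qub Qlub]].
  { exists (3 * Gamma / (8 * X)). intros r [x [_ Hr]].
    apply Rmult_le_reg_r with (8 * X); [lra|].
    replace (3 * Gamma / (8 * X) * (8 * X)) with (3 * Gamma) by (field; lra).
    destruct Hr as [-> | ->]; [apply G0' | apply G1']. }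
  { exists (Cmod (d1 x0)), x0. split; [lra | now right]. }
  assert (Q0 : forall x, x <= x0 -> lambda * Cmod (d0 x) <= Q)
    by (intros x Hx; apply Qub; exists x; auto).
  assert (Q1 : forall x, x <= x0 -> Cmod (d1 x) <= Q)
    by (intros x Hx; apply Qub; exists x; auto).
  assert (HQ0 : 0 <= Q) by (eapply Rle_trans; [apply Cmod_ge_0 | apply (Q1 x0); lra]).
  assert (HQG : Q * (8 * X) <= 3 * Gamma).
  { assert (h : Q <= 3 * Gamma / (8 * X)).
    { apply Qlub. intros r [x [_ Hr]].
      apply Rmult_le_reg_r with (8 * X); [lra|].
      replace (3 * Gamma / (8 * X) * (8 * X)) with (3 * Gamma) by (field; lra).
      destruct Hr as [-> | ->]; [apply G0' | apply G1']. }
    apply Rmult_le_compat_r with (r := 8 * X) in h; [|lra].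
    replace (3 * Gamma / (8 * X) * (8 * X)) with (3 * Gamma) in h by (field; lra). exact h. }
  set (M := C1 / 2 * E) in *.
  set (kappa := 21 / 4 * Q ^ 2 + M ^ 2 / 2).
  assert (Hkap : forall y, y <= x0 -> Cmod (sigma y) <= kappa).
  { intros y Hy. rewrite Heq.
    assert (a0 := Q0 y Hy). assert (a1 := Q1 y Hy). assert (b0 := Cmod_ge_0 (d0 y)).
    assert (b1 := Cmod_ge_0 (d1 y)).
    assert (small : Cmod (d0 y) <= 2 / 5).
    { assert (h := G0' y). assert (lambda * Cmod (d0 y) * 32 <= 3 * Gamma) by nra. nra. }
    assert (h := S_op_bound lambda d0 y small). rewrite HD in h.
    assert (h1 : Cmod (d1 y) ^ 2 <= Q ^ 2) by (apply pow_incr; lra).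
    assert (h2 : (lambda * Cmod (d0 y)) ^ 2 <= Q ^ 2) by (apply pow_incr; split; nra).
    assert (h3 := Hpn y Hy).
    eapply Rle_trans; [apply Cmod_triangle|].
    assert (h4 := Cmod_triangle (S_op lambda d0 y) (p y)). unfold kappa. lra. }
  assert (Hh : 0 <= PI / (2 * lambda)) by (apply Rlt_le, Rdiv_lt_0_compat; lra).
  assert (k0 : 0 <= kappa) by (eapply Rle_trans; [apply Cmod_ge_0 | apply (Hkap x0); lra]).
  assert (n0 : 0 <= INR n) by apply pos_INR.
  assert (Hhalf' : forall y, y <= x0 ->
     Cmod (d0 y + d0 (y - PI / (2 * lambda))%R)%C <= / (2 * lambda) * (kappa * (PI / (2 * lambda)))
     /\ Cmod (d1 y + d1 (y - PI / (2 * lambda))%R)%C <= kappa * (PI / (2 * lambda))).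
  { intros y Hy. apply Hhalf. intros z Hz. apply Hkap. lra. }
  assert (HQ : Q <= Gamma * E / 2 + INR n * (kappa * (PI / (2 * lambda)) / 2)).
  { apply Qlub. intros r [x [Hx [-> | ->]]].
    - assert (h := iter_half_diff_close _ _ x0 d0 n Hh (fun y Hy => proj1 (Hhalf' y Hy)) x Hx).
      assert (h2 := R0' x).
      set (g := Nat.iter n (half_diff (PI / (2 * lambda))) d0 x) in *.
      assert (h3 : Cmod (d0 x) <= Cmod (d0 x - g)%C + Cmod g).
      { replace (d0 x) with (d0 x - g + g)%C at 1 by ring. apply Cmod_triangle. }
      apply Rmult_le_compat_l with (r := lambda) in h; [|lra].
      apply Rmult_le_compat_l with (r := lambda) in h3; [|lra].
      replace (lambda * (INR n * (/ (2 * lambda) * (kappa * (PI / (2 * lambda))) / 2))) with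
        (INR n * (kappa * (PI / (2 * lambda)) / 2) / 2) in h by (field; lra).
      assert (0 <= INR n * (kappa * (PI / (2 * lambda)) / 2)).
      { apply Rmult_le_pos; [assumption|]. assert (0 <= kappa * (PI / (2 * lambda))) by
          (now apply Rmult_le_pos). lra. }
      lra.
    - assert (h := iter_half_diff_close _ _ x0 d1 n Hh (fun y Hy => proj2 (Hhalf' y Hy)) x Hx).
      assert (h2 := R1' x).
      set (g := Nat.iter n (half_diff (PI / (2 * lambda))) d1 x) in *.
      assert (h3 : Cmod (d1 x) <= Cmod (d1 x - g)%C + Cmod g).
      { replace (d1 x) with (d1 x - g + g)%C at 1 by ring. apply Cmod_triangle. }
      lra. }
  assert (Hfin : Q <= M).
  { apply (quadratic_closure lambda Gamma X C1 E Q (INR n)); try assumption; try reflexivity; lra. }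
  intros x Hx. rewrite HD. split; (eapply Rle_trans; [|exact Hfin]); auto.
Qed.

Theorem theorem14
  (q t p : R -> R)
  (hq_smooth : smooth q)
  (hq_pos : forall u : R, 0 < q u)
  (ht_right : forall x : R, phase q (t x) = x)
  (ht_left : forall s : R, t (phase q s) = s)
  (hp : forall x : R, p x = 2 * schwarzian t x)
  (hp_schwartz : schwartz (fun x => RtoC (p x)))
  (lambda Gamma mu : R)
  (hlambda : 0 < lambda) (hGamma : 0 < Gamma) (hmu : 0 < mu)
  (hlambda_ge : lambda >= 4 * Rmax (1 / mu) Gamma)
  (hp_fourier : forall xi : R,
     Cmod (fourier (fun x => RtoC (p x)) xi) <= Gamma * exp (- mu * Rabs xi))
  (sigma nu : R -> C)
  (hsigma_schwartz : schwartz sigma)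
  (hnu_schwartz : schwartz nu)
  (hsigma : forall x : R,
     sigma x = (S_op lambda (T_op lambda sigma) x + RtoC (p x) + nu x)%C)
  (hsigma_fourier_le : forall xi : R, Rabs xi <= sqrt 2 * lambda ->
     Cmod (fourier sigma xi) <= 3 * Gamma / 2 * exp (- mu * Rabs xi))
  (hsigma_fourier_0 : forall xi : R, Rabs xi > sqrt 2 * lambda ->
     fourier sigma xi = RtoC 0)
  (hnu : Rbar_le (sup_norm nu) (Finite (Gamma / mu * exp (- mu * lambda))))
  (C1 : R)
  (hC1 : C1 = Rmax (24 * Gamma) (sqrt (16 * Gamma / mu)))
  (hlambda_max : lambda >=
     Rmax (4 * Gamma)
       (Rmax (4 / mu)
          (Rmax (Gamma / (4 * mu)) (2 / mu * lambert_W0 (C1 * mu)))))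
  (x0 : R)
  (hp_le : forall x : R, x <= x0 ->
     Rabs (p x) <= C1 ^ 2 / 16 * exp (- mu * lambda)) :
  let delta := T_op lambda sigma in
  forall x : R, x <= x0 ->
    Cmod (delta x) <= C1 / (2 * lambda) * exp (- (mu * lambda / 2)) /\
    Cmod (CDerive delta x) <= C1 / 2 * exp (- (mu * lambda / 2)).
Proof.
  intros delta x Hx.
  assert (HGl : 4 * Gamma <= lambda).
  { assert (h := Rmax_r (1 / mu) Gamma). lra. }
  assert (Hml : 4 * (1 / mu) <= lambda).
  { assert (h := Rmax_l (1 / mu) Gamma). lra. }
  assert (HX : 4 <= mu * lambda).
  { apply Rmult_le_compat_l with (r := mu) in Hml; [|lra].
    replace (mu * (4 * (1 / mu))) with 4 in Hml by (field; lra). exact Hml. }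
  assert (Hgm : 0 < Gamma / mu) by now apply Rdiv_lt_0_compat.
  (* This is where the second entry of the maximum C1 serves: nu is then bounded by the
     same quantity as p. *)
  assert (HCsq : 16 * Gamma / mu <= C1 ^ 2).
  { rewrite <- (sqrt_sqrt (16 * Gamma / mu)) by (unfold Rdiv in *; lra).
    assert (h := Rmax_r (24 * Gamma) (sqrt (16 * Gamma / mu))). rewrite <- hC1 in h.
    assert (q0 := sqrt_pos (16 * Gamma / mu)). nra. }
  assert (HC : 24 * Gamma <= C1 <= 6 * lambda).
  { split; [rewrite hC1; apply Rmax_l|]. rewrite hC1. apply Rmax_lub; [lra|].
    apply Rle_trans with (sqrt (lambda ^ 2)).
    - apply sqrt_le_1_alt.
      replace (16 * Gamma / mu) with (4 * Gamma * (4 * (1 / mu))) by (field; lra).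
      simpl. rewrite Rmult_1_r. apply Rmult_le_compat; try lra.
      assert (0 < 1 / mu) by (apply Rdiv_lt_0_compat; lra). lra.
    - rewrite sqrt_pow2; lra. }
  assert (HE : exp (- mu * lambda) = exp (- (mu * lambda / 2)) ^ 2).
  { simpl. rewrite Rmult_1_r, <- exp_plus. f_equal. field. }
  assert (Hnu : forall y, Cmod (nu y) <= Gamma / mu * exp (- mu * lambda)).
  { intros y. destruct (Lub_Rbar_correct (fun r => exists z, r = Cmod (nu z))) as [Hub _].
    assert (h := Rbar_le_trans _ _ _ (Hub (Cmod (nu y)) (ex_intro _ y eq_refl)) hnu).
    exact h. }
  destruct (oscillator_small_on_left lambda Gamma mu C1 x0 (fun x => RtoC (p x)) sigma nu
    hlambda hGamma hmu HGl HX HC hsigma_schwartz hsigma hsigma_fourier_le hsigma_fourier_0)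
    with (x := x) as [h0 h1]; [|exact Hx|].
  - intros y Hy. rewrite Cmod_R. specialize (hp_le y Hy). specialize (Hnu y).
    rewrite HE in hp_le, Hnu.
    set (E := exp (- (mu * lambda / 2))) in *.
    assert (Gamma / mu * E ^ 2 <= C1 ^ 2 / 16 * E ^ 2).
    { apply Rmult_le_compat_r; [apply pow2_ge_0|]. unfold Rdiv in *. lra. }
    replace ((C1 / 2 * E) ^ 2 / 2) with (C1 ^ 2 / 16 * E ^ 2 + C1 ^ 2 / 16 * E ^ 2) by field.
    lra.
  - split; [|exact h1]. apply Rmult_le_reg_l with lambda; [assumption|].
    replace (lambda * (C1 / (2 * lambda) * exp (- (mu * lambda / 2)))) with
      (C1 / 2 * exp (- (mu * lambda / 2))) by (field; lra). exact h0.
Qed.
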